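(* Let $\mathbf{X}=\mathbb{R}^n$, let $T\geq 0$ be an integer, let $x_0\in\mathbf{X}$ and let $f:\mathbf{X}^{T+1}\to\overline{\mathbb{R}}$ be universally measurable. Then \[ \sup_{\mu\in\mathcal{M}^T(x_0)}\mu[f]=\sup_ME[f(M_0,\dots,M_T)], \] where the supremum on the right-hand side is taken over all $n$-dimensional martingales $M=(M_0,\dots,M_T)$ with $M_0=x_0$, each on its own filtered probability space.
   Context: $\overline{\mathbb{R}}=[-\infty,\infty]$, with the convention $\infty-\infty=-\infty$ in the definition of integrals and expectations; that is, the expectation of a random variable whose positive and negative parts both have infinite expectation is $-\infty$. A martingale is simple if it takes finitely many values; $\mathcal{M}^T(x_0)$ is the set of laws on $\mathbf{X}^{T+1}$ of $\mathbf{X}$-valued simple martingales $(M_0,\dots,M_T)$ with $M_0=x_0$ (these laws have finite support). $\mu[f]=\int f\,d\mu$. *)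

(* Defs.v *)
From HB Require Import structures.
From mathcomp Require Import all_boot all_order all_algebra.
From mathcomp Require Import all_classical all_reals all_analysis.
From mathcomp Require Import measurable_realfun.

Set Implicit Arguments.
Unset Strict Implicit.
Unset Printing Implicit Defensive.
Import Order.TTheory GRing.Theory Num.Theory.
Import numFieldNormedType.Exports.

Local Open Scope classical_set_scope.
Local Open Scope ring_scope.

(* R^n, with the product (= Borel) sigma-algebra of the library. *)
Notation euclidean R n := (n.-tuple R).

(* (R^n)^(T+1), again with the product (= Borel) sigma-algebra. *)
Notation path_space R n T := (T.+1.-tuple (euclidean R n)).

Section universal_measurability.
Local Open Scope ereal_scope.
Context {d} {S : measurableType d} {R : realType}.

(* completed_algebra_gen mu = {A `|` N | A measurable, N mu-negligible} is the
   completion of the sigma-algebra of S with respect to mu. *)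
Definition universally_measurable_set (A : set S) :=
  forall mu : probability S R, completed_algebra_gen mu A.

Definition universally_measurable_fun (f : S -> \bar R) :=
  forall B : set (\bar R), measurable B -> universally_measurable_set (f @^-1` B).

End universal_measurability.

(* The integrands f (M_0, ..., M_T) of the theorem are only measurable for the
   completion of the underlying measure. The library integral of a function
   f is the difference (with +oo - +oo = -oo) of the suprema of the integrals
   of the simple functions below f^\+ and below f^\-; the next lemma shows that
   it needs no completion: it agrees with the integral of any measurable
   version of f. *)
Section integral_completion.
Local Open Scope ereal_scope.
Context d (S : measurableType d) (R : realType).
Variable mu : {measure set S -> \bar R}.
Import HBNNSimple.

Let ge0_integral_version (f g : S -> \bar R) :
    (forall x, 0 <= f x) -> (forall x, 0 <= g x) ->
    measurable_fun setT g -> (\forall x \ae mu, f x = g x) ->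
  \int[mu]_x f x = \int[mu]_x g x.
Proof.
move=> f0 g0 mg [N [mN muN0 fgN]].
have fg x : ~ N x -> f x = g x by move=> Nx; apply: contrapT => /fgN.
apply/eqP; rewrite eq_le; apply/andP; split.
  rewrite [leLHS]ge0_integralTE//; apply: ge_ereal_sup => _ [h hf <-] /=.
  rewrite -integralT_nnsfun; apply: ae_ge0_le_integral => //.
  - by move=> x _; rewrite lee_fin.
  - exact/measurable_EFinP.
  - exists N; split=> // x /= hgx; apply: contrapT => Nx.
    by apply: hgx => _; rewrite -fg.
rewrite [leLHS]ge0_integralTE//; apply: ge_ereal_sup => _ [h hg <-] /=.
have mNC : measurable (~` N) by exact: measurableC.
have -> : sintegral mu h = sintegral mu (proj_nnsfun h mNC).
  rewrite -!integralT_nnsfun; apply: ge0_ae_eq_integral => //.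
  - exact/measurable_EFinP.
  - exact/measurable_EFinP.
  - by move=> x _; rewrite lee_fin.
  - by move=> x _; rewrite lee_fin.
  - exists N; split=> // x /= hx; apply: contrapT => Nx; apply: hx => _.
    by rewrite mindicE mem_set// mulr1.
rewrite ge0_integralTE//; apply: ereal_sup_ubound => /=.
exists (proj_nnsfun h mNC) => //= x; rewrite mindicE.
have [/set_mem Nx|/negP Nx] := boolP (x \in ~` N).
  by rewrite mulr1 fg.
by rewrite mulr0.
Qed.

Lemma integral_version (f g : S -> \bar R) :
    measurable_fun setT g -> (\forall x \ae mu, f x = g x) ->
  \int[mu]_x f x = \int[mu]_x g x.
Proof.
move=> mg fg; rewrite integralE [RHS]integralE.
congr (_ - _); apply: ge0_integral_version => //.
- exact: measurable_funepos.
- by apply: filterS fg => x fgx; rewrite !funeposE fgx.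
- exact: measurable_funeneg.
- by apply: filterS fg => x fgx; rewrite !funenegE fgx.
Qed.

End integral_completion.

Section martingales.
Local Open Scope ereal_scope.
Context {d} {Omega : measurableType d} {R : realType}.

Definition sub_measurable (G : set (set Omega)) {d'} {S : measurableType d'}
    (X : Omega -> S) :=
  forall B, measurable B -> G (X @^-1` B).

(* Y is a version of the conditional expectation of X given G. *)
Definition is_cond_expectation (P : probability Omega R)
    (G : set (set Omega)) (X Y : Omega -> R) :=
  [/\ sub_measurable G Y,
      P.-integrable setT (EFin \o Y) &
      forall A, G A -> \int[P]_(w in A) (Y w)%:E = \int[P]_(w in A) (X w)%:E].

Definition filtration {T : nat} (F : 'I_T.+1 -> set (set Omega)) :=
  (forall t, sigma_algebra setT (F t) /\ F t `<=` measurable) /\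
  (forall s t : 'I_T.+1, (s <= t)%N -> F s `<=` F t).

Definition component {n : nat} (X : Omega -> euclidean R n) (i : 'I_n) : Omega -> R :=
  fun w => tnth (X w) i.

Definition martingale {n T : nat} (P : probability Omega R)
    (F : 'I_T.+1 -> set (set Omega)) (M : 'I_T.+1 -> Omega -> euclidean R n) :=
  [/\ filtration F,
      forall t, sub_measurable (F t) (M t),
      forall t i, P.-integrable setT (EFin \o component (M t) i) &
      forall s t : 'I_T.+1, (s <= t)%N -> forall i,
        is_cond_expectation P (F s) (component (M t) i) (component (M s) i)].

Definition path_of {n T : nat} (M : 'I_T.+1 -> Omega -> euclidean R n) :
    Omega -> path_space R n T :=
  fun w => [tuple M t w | t < T.+1].

Definition starts_at {n T : nat} (P : probability Omega R)
    (M : 'I_T.+1 -> Omega -> euclidean R n) (x0 : euclidean R n) :=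
  \forall w \ae P, M ord0 w = x0.

Definition simple_process {n T : nat} (M : 'I_T.+1 -> Omega -> euclidean R n) :=
  forall t, finite_set (range (M t)).

End martingales.

Definition simple_martingale_laws {R : realType} {n : nat} (T : nat)
    (x0 : euclidean R n) : set (probability (path_space R n T) R) :=
  [set mu | exists (d : measure_display) (Omega : measurableType d)
     (P : probability Omega R) (F : 'I_T.+1 -> set (set Omega))
     (M : 'I_T.+1 -> Omega -> euclidean R n),
     [/\ martingale P F M, starts_at P M x0, simple_process M &
       forall A, measurable A -> mu A = pushforward P (path_of M) A]].
Arguments simple_martingale_laws {R n} T x0.

Definition martingale_expectations {R : realType} {n T : nat}
    (f : path_space R n T -> \bar R) (x0 : euclidean R n) : set (\bar R) :=
  [set E | exists (d : measure_display) (Omega : measurableType d)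
     (P : probability Omega R) (F : 'I_T.+1 -> set (set Omega))
     (M : 'I_T.+1 -> Omega -> euclidean R n),
     [/\ martingale P F M, starts_at P M x0 &
       E = (\int[P]_w f (path_of M w))%E]].

(* Main.v *)
(* E f(M) depends only on the law of M, so the content is that simple martingales
   do as well as all others. Let M be a martingale with E f(M) > c. Under its law,
   f dominates a Borel function g equal to f almost surely, and g may be lowered
   to an integrable real function whose expectation is still at least c. Going
   backward in time, replace g by its conditional expectation given M_0, ..., M_t:
   for almost every history, the pair formed by M_t and this conditional
   expectation is the mean of the pair formed by M_(t+1) and the previous function
   under a regular conditional distribution. The mean of an integrable vector is a
   finite convex combination of its values, even of its values off a given null
   set, so almost every history has a finitely supported one-step continuation
   with the right mean and the right value. At time 0 these continuations are
   concatenated into a simple martingale. As the resulting tree is finite, one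
   continuation is chosen at each node and no measurable selection is needed. *)
From HB Require Import structures.
Require Import Defs.
From mathcomp Require Import all_boot all_order all_algebra.
From mathcomp Require Import all_classical all_reals all_analysis.
From mathcomp Require Import measurable_realfun ring lra.

Set Implicit Arguments.
Unset Strict Implicit.
Unset Printing Implicit Defensive.
Import Order.TTheory GRing.Theory Num.Theory.
Import numFieldNormedType.Exports.

Local Open Scope classical_set_scope.
Local Open Scope ring_scope.

(** * Expectations as finite convex combinations *)

Section zero_combination.
Context {R : realType}.

Lemma ge0_integral0_null d (Y : measurableType d)
    (mu : {measure set Y -> \bar R}) (D : set Y) (X : Y -> R) :
    measurable D -> mu.-integrable D (EFin \o X) ->
    (forall y, D y -> 0 <= X y) -> (\int[mu]_(y in D) (X y)%:E = 0)%E ->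
  mu (D `&` [set y | X y != 0]) = 0%E.
Proof.
move=> mD iX X0 intX.
have mX := measurable_int mu iX.
have /(ae_eq_integral_abs mu mD mX) [N [mN N0 sN]] :
    (\int[mu]_(y in D) `|(EFin \o X) y|)%E = 0%E.
  rewrite -intX; apply: eq_integral => y /set_mem Dy /=.
  by rewrite ger0_norm// X0.
apply: (subset_measure0 _ _ _ N0) => //.
  have -> : [set y | X y != 0] = (X @^-1` [set~ 0]).
    by apply/seteqP; split=> y /= /eqP.
  move/measurable_EFinP: mX => mX; apply: mX => //.
  exact: measurableC.
move=> y [Dy /eqP Xy]; apply: sN => /= /(_ Dy) [] //.
Qed.

Lemma integral_prodM d1 d2 (Y1 : measurableType d1) (Y2 : measurableType d2)
    (m1 : probability Y1 R) (m2 : probability Y2 R)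
    (A : set Y1) (B : set Y2) (f : Y1 -> R) (g : Y2 -> R) :
    measurable A -> measurable B ->
    m1.-integrable A (EFin \o f) -> m2.-integrable B (EFin \o g) ->
  (m1 \x m2)%E.-integrable (A `*` B) (fun z => (f z.1 * g z.2)%:E) /\
  (\int[m1 \x m2]_(z in A `*` B) (f z.1 * g z.2)%:E =
   (\int[m1]_(y in A) (f y)%:E) * (\int[m2]_(y in B) (g y)%:E))%E.
Proof.
move=> mA mB fA gB.
have mAB : measurable (A `*` B) by exact: measurableX.
pose f' := (f \_ A); pose g' := (g \_ B).
have patchf x : ((EFin \o f) \_ A) x = (f' x)%:E.
  by rewrite /f' !patchE; case: ifP.
have patchg x : ((EFin \o g) \_ B) x = (g' x)%:E.
  by rewrite /g' !patchE; case: ifP.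
have if' : m1.-integrable setT (EFin \o f').
  by rewrite (_ : _ \o _ = (EFin \o f) \_ A);
    [exact: (integrable_mkcond (EFin \o f) mA).1|exact/esym/funext].
have ig' : m2.-integrable setT (EFin \o g').
  by rewrite (_ : _ \o _ = (EFin \o g) \_ B);
    [exact: (integrable_mkcond (EFin \o g) mB).1|exact/esym/funext].
have mf' : measurable_fun setT f' by apply/measurable_EFinP/(measurable_int m1).
have mg' : measurable_fun setT g' by apply/measurable_EFinP/(measurable_int m2).
have patchfg z : ((fun z => (f z.1 * g z.2)%:E) \_ (A `*` B)) z =
    (f' z.1 * g' z.2)%:E.
  rewrite /f' /g' !patchE in_setX; case: (z.1 \in A); case: (z.2 \in B) => //=;
  by rewrite ?(mul0r,mulr0).
have mfg : measurable_fun setT (fun z : Y1 * Y2 => (f' z.1 * g' z.2)%:E).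
  apply/measurable_EFinP; apply: measurable_funM.
  - exact: measurableT_comp.
  - exact: measurableT_comp.
have ifg : (m1 \x m2)%E.-integrable setT (fun z => (f' z.1 * g' z.2)%:E).
  apply/integrable12ltyP => //.
  have -> : (\int[m1]_x \int[m2]_y `|(f' (x, y).1 * g' (x, y).2)%:E|)%E =
      ((\int[m1]_x `|(f' x)%:E|) * \int[m2]_y `|(g' y)%:E|)%E.
    rewrite -ge0_integralZr//=.
    - apply: eq_integral => x _; rewrite -ge0_integralZl//=.
      + by apply: eq_integral => y _; rewrite normrM EFinM.
      + by apply/measurable_EFinP; exact: measurableT_comp.
    - by apply/measurable_EFinP; exact: measurableT_comp.
    - exact: integral_ge0.
  move/integrableP : if' => [_ if']; move/integrableP : ig' => [_ ig'].
  by apply: lte_mul_pinfty => //; [exact: integral_ge0|rewrite ge0_fin_numE//;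
    exact: integral_ge0].
split.
  by apply/(integrable_mkcond _ mAB); apply: eq_integrable ifg => // z _;
    rewrite patchfg.
rewrite integral_mkcond; under eq_integral do rewrite patchfg.
rewrite -(integral12_prod_meas1 ifg) /fubini_F.
rewrite [X in (_ = X * _)%E]integral_mkcond [X in (_ = _ * X)%E]integral_mkcond.
under [X in (_ = X * _)%E]eq_integral do rewrite patchf.
under [X in (_ = _ * X)%E]eq_integral do rewrite patchg.
have gfin : (\int[m2]_y (g' y)%:E)%E \is a fin_num by exact: integrable_fin_num.
rewrite -(fineK gfin) -integralZr//.
apply: eq_integral => x _ /=.
rewrite (fineK gfin) -integralZl//.
Qed.

(* Pairing a point where X = phi ord0 is negative with one where it is
   nonnegative, with weights X y2 and - X y1, cancels the coordinate X. The
   remaining coordinates, averaged with these weights over the product space,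
   still have integral 0. *)
Lemma zero_combination m : forall d (Y : measurableType d)
    (mu : probability Y R) (D : set Y) (phi : 'I_m -> Y -> R),
    measurable D -> mu D != 0%E ->
    (forall i, mu.-integrable D (EFin \o phi i)) ->
    (forall i, \int[mu]_(y in D) (phi i y)%:E = 0)%E ->
  exists (J : finType) (w : J -> R) (y : J -> Y),
    [/\ forall j, 0 <= w j, 0 < \sum_j w j, forall j, D (y j) &
        forall i, \sum_j w j * phi i (y j) = 0].
Proof.
elim: m => [|m IH] d Y mu D phi mD D0 iphi intphi.
  have [y Dy] : D !=set0.
    by apply/set0P; apply: contra_neq D0 => ->; rewrite measure0.
  exists unit, (fun=> 1), (fun=> y); split=> //; last by case.
  by rewrite big_const card_unit /= addr0.
set X := phi ord0.
have mX : measurable_fun D X by apply/measurable_EFinP/(measurable_int mu)/iphi.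
pose Dn := D `&` X @^-1` `]-oo, 0[; pose Dp := D `&` X @^-1` `[0, +oo[.
have mDn : measurable Dn by exact: mX.
have mDp : measurable Dp by exact: mX.
have DE : D = Dn `|` Dp.
  rewrite -setIUr; apply/seteqP; split=> [y Dy|y []//]; split => //=.
  by rewrite !in_itv/= andbT; case: ltP => _; [left|right].
have dnp : [disjoint Dn & Dp].
  apply/disj_setPS => y [[_ /=]]; rewrite in_itv/= => y1 [_ /=].
  by rewrite in_itv/= andbT leNgt y1.
have intU (f : Y -> R) : mu.-integrable D (EFin \o f) ->
    (\int[mu]_(y in D) (f y)%:E =
     \int[mu]_(y in Dn) (f y)%:E + \int[mu]_(y in Dp) (f y)%:E)%E.
  by move=> fi; rewrite DE integral_setU// -DE; exact: (measurable_int mu).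
have iDn i : mu.-integrable Dn (EFin \o phi i).
  by apply: (integrableS mD) => // y [].
have iDp i : mu.-integrable Dp (EFin \o phi i).
  by apply: (integrableS mD) => // y [].
have mN0 : measurable (D `&` [set y | X y != 0]).
  have -> : [set y | X y != 0] = (X @^-1` [set~ 0]).
    by apply/seteqP; split=> y /= /eqP.
  by apply: mX => //; exact: measurableC.
(* If [X] vanishes almost everywhere on [D], discarding the null set where it does not makes this
   coordinate vanish at every chosen point, and induction handles the others. *)
have [N0|N0] := eqVneq (mu (D `&` [set y | X y != 0])) 0%E.
  have mZ : measurable (D `\` (D `&` [set y | X y != 0])) by exact: measurableD.
  have [||i|i|J [w [y [w0 w1 Dy phi0]]]] := IH d Y mu
    (D `\` (D `&` [set y | X y != 0])) (fun i => phi (lift ord0 i)).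
  - exact: mZ.
  - rewrite measureD//= ?setIA ?setIid ?N0 ?sube0//.
    by rewrite ltey_eq fin_num_measure.
  - by apply: (integrableS mD) => // y [].
  - rewrite -negligible_integral//. exact: iphi.
  exists J, w, y; split => // [j|i]; first by have [] := Dy j.
  have [->|i0] := eqVneq i ord0; last first.
    by move: (i0); rewrite eq_sym => /unlift_some[k -> _]; exact: phi0.
  rewrite -/X big1// => j _; have [Dj /not_andP[//|/negP/negPn/eqP->]] := Dy j.
  by rewrite mulr0.
(* If [X] had one sign, recorded by [s], on almost all of [D], its zero integral would force it to
   vanish almost everywhere, against [N0]. Hence both [Dn] and [Dp] have positive mass. *)
have int0 (E : set Y) (s : R) : measurable E -> E `<=` D -> s != 0 ->
    (forall y, E y -> 0 <= s * X y) -> mu (D `\` E) = 0%E ->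
    mu (D `&` [set y | X y != 0]) = 0%E.
  move=> mE ED s0 E0 DE0.
  have iE : mu.-integrable E (EFin \o (fun y => s * X y)).
    apply: (integrableS mD) => //.
    rewrite (_ : _ \o _ = (fun y => s%:E * (X y)%:E)%E)//.
    by apply: integrableZl => //; exact: iphi.
  have := ge0_integral0_null mE iE E0.
  have -> : (\int[mu]_(y in E) (s * X y)%:E = 0)%E.
    under eq_integral do rewrite EFinM.
    rewrite integralZl//; last exact: (integrableS mD _ _ (iphi ord0)).
    have := intphi ord0.
    rewrite (negligible_integral (measurableD mD mE) mD (iphi ord0) DE0).
    by rewrite setDD setIidr// => ->; rewrite mule0.
  move=> /(_ erefl) E00.
  have mE' : measurable (E `&` [set y | s * X y != 0]).
    rewrite (_ : _ `&` _ = E `&` (D `&` [set y | X y != 0]));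
      first exact: measurableI.
    rewrite setIA (setIidl ED); congr (_ `&` _); apply/seteqP.
    by split=> y /=; rewrite mulf_eq0 negb_or s0.
  apply: (subset_measure0 mN0 (measurableU _ _ (measurableD mD mE) mE')).
    move=> y [Dy Xy]; have [Ey|Ey] := pselect (E y); last by left.
    by right; split => //=; rewrite mulf_eq0 negb_or s0.
  apply/eqP; rewrite eq_le measure_ge0 andbT.
  apply: le_trans (measureU2 _ (measurableD mD mE) mE') _.
  by rewrite [leLHS]/= DE0 E00 adde0.
have Dn0 : mu Dn != 0%E.
  apply: contra_neq N0 => Dn0; apply: (int0 Dp 1) => //.
  - by move=> y [].
  - by move=> y [_]/=; rewrite in_itv/= andbT mul1r.
  - rewrite {1}DE setDUl setDv setU0 setDidl//.
    by apply/eqP; rewrite -disj_set2E.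
have Dp0 : mu Dp != 0%E.
  apply: contra_neq N0 => Dp0; apply: (int0 Dn (-1)) => //.
  - by move=> y [].
  - by move=> y [_]/=; rewrite in_itv/= mulN1r oppr_ge0 => /ltW.
  - rewrite {1}DE setDUl setDv set0U setDidl//.
    by rewrite setIC; apply/eqP; rewrite -disj_set2E.
(* Each coordinate has opposite integrals over [Dn] and [Dp], so the two products in the integral of
   [psi i] over the rectangle cancel. *)
pose psi i (z : Y * Y) :=
  phi (lift ord0 i) z.1 * X z.2 - X z.1 * phi (lift ord0 i) z.2.
have [iL1 eL1] := all_and2 (fun i => integral_prodM mDn mDp (iDn i) (iDp ord0)).
have [iL2 eL2] := all_and2 (fun i => integral_prodM mDn mDp (iDn ord0) (iDp i)).
have [||i|i|J [w [y [w0 w1 Dy phi0]]]] := IH _ _ (mu \x mu)%E (Dn `*` Dp) psi.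
- exact: measurableX.
- by rewrite /= product_measure1E// mule_neq0.
- have := integrableB (measurableX mDn mDp) (iL1 (lift ord0 i)) (iL2 (lift ord0
    i)).
  by apply: eq_integrable; [exact: measurableX|].
- rewrite /psi; under eq_integral do rewrite EFinB.
  rewrite integralB_EFin//; [|exact: measurableX|exact: iL1|exact: iL2].
  rewrite eL1 eL2.
  have := intU _ (iphi ord0); have := intU _ (iphi (lift ord0 i)).
  rewrite !intphi -/X.
  have /fineK <- := integrable_fin_num mDn (iDn ord0).
  have /fineK <- := integrable_fin_num mDp (iDp ord0).
  have /fineK <- := integrable_fin_num mDn (iDn (lift ord0 i)).
  have /fineK <- := integrable_fin_num mDp (iDp (lift ord0 i)).
  rewrite /= -!EFinM -!EFinD => -[a0] [b0]; congr (_%:E).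
  by nra.
have Xn j : X (y j).1 < 0 by have [[_]] := Dy j; rewrite /= in_itv.
have Xp j : 0 <= X (y j).2 by have [_ [_]] := Dy j; rewrite /= in_itv/= andbT.
exists (J * bool)%type,
  (fun p => w p.1 * if p.2 then X (y p.1).2 else - X (y p.1).1),
  (fun p => if p.2 then (y p.1).1 else (y p.1).2).
split.
- move=> [j []]/=; first by rewrite mulr_ge0.
  by rewrite mulr_ge0// oppr_ge0 ltW.
- rewrite -(pair_big xpredT xpredT (fun j b => w j * if b then X (y j).2 else -
    X (y j).1))/=.
  (* The two weights of the pair [j] add up to [w j] times a positive number, so a zero total would
     force every [w j] to vanish. *)
  have t0 j : 0 <= w j * (X (y j).2 - X (y j).1).
    by rewrite mulr_ge0// subr_ge0 (le_trans (ltW (Xn j))).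
  rewrite (eq_bigr (fun j => w j * (X (y j).2 - X (y j).1))); last first.
    by move=> j _; rewrite big_bool/= -mulrDr.
  rewrite lt_neqAle sumr_ge0// andbT eq_sym; apply/eqP => /psumr_eq0P t00.
  move: w1; rewrite big1 ?ltxx// => j _;
    have /eqP := t00 (fun i _ => t0 i) j isT.
  rewrite mulf_eq0 => /orP[/eqP//|]; rewrite subr_eq0 => /eqP XX.
  by have := Xn j; rewrite -XX ltNge Xp.
- by move=> [j []]/=; have [[? ?] [? ?]] := Dy j.
move=> i.
rewrite -(pair_big xpredT xpredT (fun j b => (w j * if b then X (y j).2 else -
  X (y j).1) *
  phi i (if b then (y j).1 else (y j).2)))/=.
have [->|i0] := eqVneq i ord0.
  by rewrite big1// => j _; rewrite big_bool/= -/X; ring.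
move: i0; rewrite eq_sym => /unlift_some[k -> _]; rewrite -[RHS](phi0 k).
by apply: eq_bigr => j _; rewrite big_bool/= /psi; ring.
Qed.

End zero_combination.

(** * Regular conditional distributions *)

Section restricted_image.
Context d d' (X : measurableType d) (S : measurableType d') (R : realType).
Variables (mu : probability X R) (p : {mfun X >-> S}).

(** The measurability proof is an argument so that the measure structures below, which rest on it,
    can be inferred from the term. *)
Definition restricted_image (C : set X) & measurable C :=
  fun A : set S => mu (p @^-1` A `&` C).

Variables (C : set X) (mC : measurable C).

Local Notation mu_C := (restricted_image mC).

Let mpC A : measurable A -> measurable (p @^-1` A `&` C).
Proof. by move=> mA; apply: measurableI => //; exact: measurable_funPTI. Qed.

Let ri0 : mu_C set0 = 0%E.
Proof. by rewrite /restricted_image preimage_set0 set0I measure0. Qed.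

Let ri_ge0 A : (0 <= mu_C A)%E.
Proof. exact: measure_ge0. Qed.

Let ri_sigma : semi_sigma_additive mu_C.
Proof.
move=> F mF tF mUF; rewrite /restricted_image preimage_bigcup setI_bigcupl.
apply: (@measure_semi_sigma_additive _ _ _ mu (fun n => p @^-1` F n `&` C)).
- by move=> n; exact: mpC.
- apply/trivIsetP => i j _ _ ij; rewrite setIACA -preimage_setI.
  by move/trivIsetP : tF => /(_ _ _ _ _ ij) ->//; rewrite preimage_set0 set0I.
- by rewrite -setI_bigcupl -preimage_bigcup; exact: mpC.
Qed.

HB.instance Definition _ := isMeasure.Build _ _ _ mu_C
  ri0 ri_ge0 ri_sigma.

Let ri_fin : fin_num_fun mu_C.
Proof. by move=> A mA; rewrite fin_num_measure//; exact: mpC. Qed.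

HB.instance Definition _ :=
  Measure_isFinite.Build _ _ _ mu_C ri_fin.

(** Radon-Nikodym applies because the restricted image is dominated by the full image. The density
    at [h] is the conditional probability of [C] given that [p] equals [h]. *)
Lemma restricted_image_density : exists f : S -> \bar R,
  [/\ forall h, (0 <= f h)%E, (distribution mu p).-integrable setT f &
      forall A, measurable A ->
        mu (p @^-1` A `&` C) = (\int[distribution mu p]_(h in A) f h)%E].
Proof.
apply: (@radon_nikodym_finite _ _ _ (distribution mu p) mu_C).
apply/null_content_dominatesP => A mA muA0.
have mpA : measurable (p @^-1` A) by exact: measurable_funPTI.
exact: (subset_measure0 (mpC mA) mpA (@subIsetl _ _ _) muA0).
Qed.

End restricted_image.

Section marginal.
Context d d' (S : measurableType d) (Y : measurableType d') (R : realType).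

Definition fst_mfun : {mfun (S * Y)%type >-> S} :=
  HB.pack (@fst S Y) (@isMeasurableFun.Build _ _ _ _ (@fst S Y) measurable_fst).

Definition snd_mfun : {mfun (S * Y)%type >-> Y} :=
  HB.pack (@snd S Y) (@isMeasurableFun.Build _ _ _ _ (@snd S Y) measurable_snd).

Definition marginal (mu : probability (S * Y)%type R) : probability S R :=
  distribution mu fst_mfun.

Lemma marginal_density (mu : probability (S * Y)%type R) (B : set Y) :
  measurable B -> exists f : S -> \bar R,
  [/\ forall h, (0 <= f h)%E, (marginal mu).-integrable setT f &
      forall A, measurable A ->
        mu (A `*` B) = (\int[marginal mu]_(h in A) f h)%E].
Proof.
by move=> mB; exact: (restricted_image_density _ _ (measurable_funPTI snd_mfun
  mB)).
Qed.

(** Uniqueness of measures is used twice: for fixed [A], in the second coordinate, to pass from [G]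
    to all measurable sets; then on the product, which the measurable rectangles generate. *)
Lemma eq_probability_rectangles (m m' : probability (S * Y)%type R)
    (G : set (set Y)) (g : (set Y)^nat) :
    measurable = <<s G >> -> setI_closed G -> (forall n, G (g n)) ->
    \bigcup_n g n = setT ->
    (forall A B, measurable A -> G B -> m (A `*` B) = m' (A `*` B)) ->
  forall X, measurable X -> m X = m' X.
Proof.
move=> mG GI Gg gT mm'.
have mm'X A B : measurable A -> measurable B -> m (A `*` B) = m' (A `*` B).
  move=> mA mB; have mA' := measurable_funPTI fst_mfun mA.
  rewrite (_ : A `*` B = snd_mfun @^-1` B `&` fst_mfun @^-1` A); last first.
    by rewrite setIC.
  apply: (@measure_unique _ _ _ G g mG GI Gg gT
    (restricted_image m snd_mfun mA') (restricted_image m' snd_mfun mA') _ _ _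
      mB).
    move=> D GD; rewrite /= /restricted_image.
    by rewrite (_ : _ `&` _ = A `*` D) ?mm'// setIC.
  move=> k; rewrite ltey_eq fin_num_measure// mG; exact: sub_sigma_algebra.
move=> X mX.
apply: (@measure_unique _ _ _
  [set C | exists2 A, measurable A & exists2 B, measurable B & A `*` B = C]
  (fun=> setT)) => //.
- by rewrite measurable_prod_measurableType.
- move=> _ _ [A1 mA1 [B1 mB1 <-]] [A2 mA2 [B2 mB2 <-]].
  exists (A1 `&` A2); first exact: measurableI.
  by exists (B1 `&` B2); [exact: measurableI|rewrite setXI].
- by move=> _; exists setT => //; exists setT => //; rewrite setXTT.
- by rewrite bigcup_const.
- by move=> _ [A mA [B mB <-]]; exact: mm'X.
- by move=> _; rewrite ltey_eq fin_num_measure.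
Qed.

End marginal.

(** On the set where [g < f], the hypothesis and monotonicity give both functions the same integral
    over every measurable subset. They therefore agree almost everywhere on that set, which must be
    null. *)
Lemma ae_le_of_integral d (S : measurableType d) (R : realType)
    (nu : {measure set S -> \bar R}) (f g : S -> \bar R) :
    nu.-integrable setT f -> nu.-integrable setT g ->
    (forall A, measurable A -> (\int[nu]_(x in A) f x <= \int[nu]_(x in A) g
      x)%E) ->
  {ae nu, forall x, (f x <= g x)%E}.
Proof.
move=> fi gi fg.
have mf := measurable_int _ fi; have mg := measurable_int _ gi.
have mA : measurable [set x | (g x < f x)%E].
  by rewrite -[X in measurable X]setTI; exact: emeasurable_fun_lt.
have [N [mN N0 sN]] : ae_eq nu [set x | (g x < f x)%E] f g.
  apply: integral_ae_eq => //.
  - exact: integrableS fi.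
  - exact: measurable_funTS.
  move=> E EA mE; apply/eqP; rewrite eq_le fg//=.
  apply: le_integral => //; [exact: integrableS gi|exact: integrableS fi|].
  by move=> x /set_mem/EA/ltW.
exists N; split=> // x /= /negP; rewrite -ltNge => gf.
by apply: sN => /= /(_ gf) fgx; rewrite fgx ltxx in gf.
Qed.

Lemma ae_forall_countable d (S : measurableType d) (R : realType)
    (nu : {measure set S -> \bar R}) (I : countType) (P : I -> S -> Prop) :
  (forall i, {ae nu, forall x, P i x}) -> {ae nu, forall x, forall i, P i x}.
Proof.
move=> aeP.
have : {ae nu, forall x, forall n, if @unpickle I n is Some i then P i x else
  True}.
  apply: ae_foralln => n; case: unpickle => [i|]; first exact: aeP.
  exact: aeW.
by apply: filterS => x Px i; have := Px (pickle i); rewrite pickleK.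
Qed.

(** * Conditional distribution functions at rational points *)

Section conditional_cdf.
Context d (S : measurableType d) (R : realType) (mu :
  probability (S * R)%type R).

(** Each [F q] comes from a Radon-Nikodym density. As the rationals are countable, the bounds and
    the monotonicity hold off a single null set, on which every [F q] is set to 0. *)
Lemma conditional_cdf : exists F : rat -> S -> R,
  [/\ forall q, measurable_fun setT (F q),
      forall q h, 0 <= F q h <= 1,
      forall q r h, q <= r -> F q h <= F r h &
      forall q A, measurable A -> mu (A `*` `]-oo, ratr q]) =
        (\int[marginal mu]_(h in A) (F q h)%:E)%E].
Proof.
have /choice[g gP] : forall q : rat, exists f : S -> \bar R,
  [/\ forall h, (0 <= f h)%E, (marginal mu).-integrable setT f &
      forall A, measurable A -> mu (A `*` `]-oo, ratr q]) = (\int[marginal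
        mu]_(h in A) f h)%E].
  by move=> q; exact: marginal_density.
have g0 q h : (0 <= g q h)%E by have [] := gP q.
have ig q : (marginal mu).-integrable setT (g q) by have [] := gP q.
have mg q := measurable_int _ (ig q).
have intg q A : measurable A ->
  mu (A `*` `]-oo, ratr q]) = (\int[marginal mu]_(h in A) g q h)%E.
  by have [_ _ +] := gP q; exact.
have [N [mN N0 sN]] : {ae marginal mu, forall h,
    (forall q, (g q h <= 1)%E) /\ (forall p : rat * rat, p.1 <= p.2 ->
      (g p.1 h <= g p.2 h)%E)}.
  apply: filterI; apply: ae_forall_countable.
    move=> q; apply: ae_le_of_integral => //.
      exact: finite_measure_integrable_cst.
    move=> A mA; rewrite -intg// integral_cst// mul1e.
    apply: le_measure; rewrite ?inE//.
    - exact: measurableX.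
    - exact: (measurable_funPTI (fst_mfun S R)).
    - by move=> [h y] [].
  move=> [q r]/=; have [qr|qr] := leP q r; last by apply: aeW.
  suff : {ae marginal mu, forall x, (g q x <= g r x)%E} by apply: filterS.
  apply: ae_le_of_integral => // A mA; rewrite -!intg//.
  apply: le_measure; rewrite ?inE//; [exact: measurableX|exact: measurableX|].
  move=> [h x] [/= Ah]; rewrite !in_itv/= => xq; split => //=.
  rewrite (le_trans xq)//.
  by rewrite ler_rat.
have gN h : ~ N h -> (forall q, (g q h <= 1)%E) /\ (forall q r, q <= r ->
  (g q h <= g r h)%E).
  move=> Nh; have [g1 gle] : (forall q, (g q h <= 1)%E) /\
    (forall p : rat * rat, p.1 <= p.2 -> (g p.1 h <= g p.2 h)%E).
    by apply: contrapT => /sN.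
  by split=> // q r qr; exact: (gle (q, r)).
have gfin h q : ~ N h -> g q h \is a fin_num.
  move=> /gN[/(_ q) g1 _]; rewrite ge0_fin_numE//.
  by rewrite (le_lt_trans g1)// ltry.
exists (fun q h => fine ((g q \_ (~` N)) h)); split.
- move=> q; apply: measurableT_comp => //; apply/measurable_restrict => //.
    exact: measurableC.
  by rewrite setTI; exact: measurable_funTS.
- move=> q h; rewrite patchE; case: ifPn => [/set_mem Nh|_];
    last by rewrite lexx ler01.
  by rewrite fine_ge0//= -lee_fin fineK ?gfin//; have [->] := gN _ Nh.
- move=> q r h qr; rewrite !patchE; case: ifPn => // /set_mem Nh.
  by apply: fine_le; rewrite ?gfin//; have [_ ->] := gN _ Nh.
- move=> q A mA; rewrite intg//.
  apply: ae_eq_integral => //.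
  + exact: measurable_funTS.
  + apply/measurable_EFinP; apply: measurable_funTS;
      apply: measurableT_comp => //.
    apply/measurable_restrict => //; first exact: measurableC.
    by rewrite setTI; exact: measurable_funTS.
  + exists N; split=> // h /= gh; apply: contrapT => Nh; apply: gh => _.
    by rewrite patchE mem_set// fineK// gfin.
Qed.

End conditional_cdf.

(** A finite union of members of a chain is empty or a member of the chain, so the bound passes to
    the partial unions, and to the whole union by continuity from below. *)
Lemma bigcup_chain_le d (T : measurableType d) (R : realType)
    (mu : {measure set T -> \bar R}) (I : countType) (P : set I)
    (E : I -> set T) (c : \bar R) :
    (forall i, measurable (E i)) ->
    (forall i j, P i -> P j -> E i `<=` E j \/ E j `<=` E i) ->
    (0 <= c)%E -> (forall i, P i -> (mu (E i) <= c)%E) ->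
  (mu (\bigcup_(i in P) E i) <= c)%E.
Proof.
move=> mE chE c0 Ec.
pose G n := if @unpickle I n is Some i then (if `[< P i >] then E i else set0)
  else set0.
have mG n : measurable (G n).
  by rewrite /G; case: unpickle => // i; case: ifP.
have GE : \bigcup_(i in P) E i = \bigcup_n G n.
  apply/seteqP; split=> [x [i Pi Eix]|x [n _]].
    by exists (pickle i) => //; rewrite /G pickleK asboolT.
  by rewrite /G; case: unpickle => // i; case: asboolP => // Pi Eix; exists i.
have FE n : \big[setU/set0]_(k < n) G k = set0 \/
    exists2 i, P i & \big[setU/set0]_(k < n) G k = E i.
  elim: n => [|n]; first by left; rewrite big_ord0.
  rewrite big_ord_recr/=.
  have [->|[i Pi ->]] : G n = set0 \/ exists2 i, P i & G n = E i.
    rewrite /G; case: unpickle => [i|]; last by left.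
    by case: asboolP => Pi; [right; exists i|left].
    by rewrite setU0.
  case=> [->|[j Pj ->]]; first by right; exists i => //; rewrite set0U.
  by right; have [/setUidl|/setUidr] := chE _ _ Pi Pj => ->;
    [exists j|exists i].
rewrite GE -bigcup_bigsetU_bigcup.
have mF n : measurable (\big[setU/set0]_(k < n.+1) G k).
  by apply: bigsetU_measurable => k _.
have ndF : {homo (fun n => \big[setU/set0]_(k < n.+1) G k) :
  n m / (n <= m)%N >-> (n <= m)%O}.
  by move=> n m nm; apply/subsetPset; exact: subset_bigsetU.
have cv := @nondecreasing_cvg_mu _ _ _ mu _ mF (bigcupT_measurable _ mF) ndF.
apply: (cvge_le _ cv).
apply: nearW => n /=; have [->|[i Pi ->]] := FE n.+1; first by rewrite measure0.
exact: Ec.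
Qed.

(* uniform_prob lives on measurableTypeR R, whose sigma-algebra is that of R
   under another display. *)
Definition unit_uniform (R : realType) : probability R R :=
  let id_measurable := @isMeasurableFun.Build _ _ (measurableTypeR R) R id
    (@measurable_id _ R setT) in
  let idR : {mfun (measurableTypeR R) >-> R} := HB.pack (id :
    measurableTypeR R -> R) id_measurable in
  distribution (uniform_prob (@ltr01 R) :
    probability (measurableTypeR R) R) idR.


Lemma unit_uniform_le (R : realType) (c : R) : 0 <= c <= 1 ->
  unit_uniform R [set u | u <= c] = c%:E.
Proof.
move=> /andP[c0 c1].
rewrite /unit_uniform /= /distribution /pushforward /= preimage_id.
rewrite /uniform_prob integral_uniform_pdf.
rewrite (_ : _ `&` _ = `[0, c]%classic); last first.
  apply/seteqP; split=> x /=; rewrite !in_itv/=.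
    by move=> [-> /andP[-> _]].
  by move=> /andP[-> xc]; rewrite xc (le_trans xc).
rewrite (eq_integral (cst 1%E)); last first.
  move=> x /set_mem/=; rewrite in_itv/= /uniform_pdf => /andP[-> xc].
  by rewrite (le_trans xc)//= subr0 invr1.
rewrite integral_cst//= mul1e lebesgue_measure_itv/=.
by rewrite lte_fin sube0; case: ltgtP c0 => //= <-.
Qed.

(** * Quantile transform of a uniform variable *)

Section quantile.
Context d (S : measurableType d) (R : realType) (mu :
  probability (S * R)%type R).
Variable F : rat -> S -> R.
Hypothesis mF : forall q, measurable_fun setT (F q).
Hypothesis F01 : forall q h, 0 <= F q h <= 1.
Hypothesis ndF : forall q r h, q <= r -> F q h <= F r h.
Hypothesis muF : forall q A, measurable A ->
  mu (A `*` `]-oo, ratr q]) = (\int[marginal mu]_(h in A) (F q h)%:E)%E.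

Let E q : set (S * R) := [set z | z.2 <= F q z.1].
Let K : probability (S * R)%type R := (marginal mu \x unit_uniform R)%E.

Let mE q : measurable (E q).
Proof.
rewrite -[X in measurable X]setTI; apply: measurable_fun_ler => //.
exact: measurableT_comp.
Qed.

Let ndE q r : q <= r -> E q `<=` E r.
Proof. by move=> qr z /= /le_trans; apply; exact: ndF. Qed.

Let chE (P : set rat) q r : P q -> P r -> E q `<=` E r \/ E r `<=` E q.
Proof. by move=> _ _; have [/ndE|/ltW/ndE] := leP q r; [left|right]. Qed.

(** The section of [E q] at [h] is the set of [u] below [F q h], whose uniform mass is [F q h]. *)
Let KE q A : measurable A -> K ((A `*` setT) `&` E q) = mu (A `*` `]-oo, ratr
  q]).
Proof.
move=> mA; rewrite muF// /K /= /product_measure1 [RHS]integral_mkcond.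
apply: eq_integral => h _ /=; rewrite patchE; case: ifPn => hA.
  rewrite -(@unit_uniform_le _ (F q h))//; congr (unit_uniform R _).
  apply/seteqP; split=> u; rewrite /xsection/= inE/=; first by case.
  by move=> uF; split => //; split => //; exact/set_mem.
rewrite (_ : xsection _ _ = set0) ?measure0//.
apply/seteqP; split=> u //; rewrite /xsection/= inE/= => -[[/mem_set]].
by rewrite (negbTE hA).
Qed.

Let G : set (S * R) := (\bigcup_q E q) `&` (\bigcup_q ~` E q).

Let mG : measurable G.
Proof.
by apply: measurableI; apply: bigcupT_measurable_rat => // q;
  exact: measurableC.
Qed.

Let chX (A : set S) q r :
  A `*` `]-oo, (ratr q : R)] `<=` A `*` `]-oo, ratr r] \/
  A `*` `]-oo, (ratr r : R)] `<=` A `*` `]-oo, ratr q].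
Proof.
have sub p p' : p <= p' -> A `*` `]-oo, (ratr p :
  R)] `<=` A `*` `]-oo, ratr p'].
  move=> pp [h y] [/= Ah]; rewrite in_itv/= => yp; split => //=.
  by rewrite in_itv/= (le_trans yp)// ler_rat.
by have [/sub|/ltW/sub] := leP q r; [left|right].
Qed.

Let muT q : mu (setT `*` `]-oo, ratr q]) = K (E q).
Proof. by rewrite -KE// setXTT setTI. Qed.

Let muTC q : mu (~` (setT `*` `]-oo, ratr q])) = K (~` E q).
Proof.
rewrite probability_setC; last exact: measurableX.
by rewrite muT probability_setC.
Qed.

(** The sets [E q] have the masses under [K] that the half spaces of level [q] have under [mu]. The
    half spaces exhaust the space as [q] grows, so the chain bound gives mass 1; [K2] is the same
    argument with complements. They replace the limits of [F q h] at plus and minus infinity. *)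
Let K1 : K (\bigcup_q E q) = 1%E.
Proof.
apply/eqP; rewrite eq_le probability_le1/=; last exact: bigcupT_measurable_rat.
rewrite -(probability_setT mu).
rewrite (_ : setT = \bigcup_q (setT `*` `]-oo, ratr q])); last first.
  apply/esym/seteqP; split=> // -[h y] _.
  have yy : y < y + 1 by rewrite ltrDl.
  have [q] := rat_in_itvoo yy; rewrite in_itv/= => /andP[yq _].
  by exists q => //; split => //=; rewrite in_itv/= ltW.
apply: bigcup_chain_le; [| |exact: measure_ge0|].
- by move=> q; exact: measurableX.
- by move=> q r _ _; exact: chX.
- move=> q _; rewrite [leLHS]muT; apply: le_measure; rewrite ?inE//.
  exact: bigcupT_measurable_rat.
by move=> z Ez; exists q.
Qed.

Let K2 : K (\bigcup_q ~` E q) = 1%E.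
Proof.
have mEC q : measurable (~` E q) by exact: measurableC.
apply/eqP; rewrite eq_le probability_le1/=; last exact: bigcupT_measurable_rat.
rewrite -(probability_setT mu).
rewrite (_ : setT = \bigcup_q (~` (setT `*` `]-oo, ratr q]))); last first.
  apply/esym/seteqP; split=> // -[h y] _.
  have yy : y - 1 < y by rewrite gtrBl.
  have [q] := rat_in_itvoo yy; rewrite in_itv/= => /andP[_ qy].
  by exists q => // -[_]/=; rewrite in_itv/= leNgt qy.
apply: bigcup_chain_le; [| |exact: measure_ge0|].
- by move=> q; apply: measurableC; exact: measurableX.
- by move=> q r _ _; have [sub|sub] := chX setT q r; [right|left];
    exact: subsetC.
- move=> q _; rewrite [leLHS]muTC; apply: le_measure; rewrite ?inE//.
  exact: bigcupT_measurable_rat.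
by move=> z Ez; exists q.
Qed.

Let KG : K (~` G) = 0%E.
Proof.
have mUE : measurable (\bigcup_q E q) by exact: bigcupT_measurable_rat.
have mUCE : measurable (\bigcup_q ~` E q).
  by apply: bigcupT_measurable_rat => q; exact: measurableC.
have z1 : K (~` \bigcup_q E q) = 0%E by rewrite probability_setC// K1 subee.
have z2 : K (~` \bigcup_q ~` E q) = 0%E by rewrite probability_setC// K2 subee.
by rewrite /G setCI [LHS]measureU0 ?z1//; exact: measurableC.
Qed.

Let KIG X : measurable X -> K X = K (X `&` G).
Proof.
move=> mX; have XG0 : K (X `\` G) = 0%E.
  exact: (subset_measure0 (measurableD mX mG) (measurableC mG) (@subIsetr _ _
    _) KG).
by rewrite [LHS](measureDI K mX mG) [X in (X + _)%E]XG0 add0e.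
Qed.

(* The generalised inverse of the conditional distribution function F _ h. Off
   the null set ~` G, where the infimum is over an empty or unbounded set, it is
   given the value 0. *)
Definition quantile : S * R -> R :=
  (fun z => inf [set ratr q | q in [set q | E q z]]) \_ G.

(** The strict inequality turns a condition on the infimum into a countable union of sets [E q];
    this yields both the measurability and the law of the quantile. Membership in [G] supplies a
    point and a lower bound of the set whose infimum is taken. *)
Let quantile_lt x z : G z -> quantile z < x <-> exists2 q, ratr q < x & E q z.
Proof.
move=> Gz; rewrite /quantile patchE mem_set//;
  case: Gz => [[q0 _ Eq0] [r _ /= Er]].
split.
  move=> /inf_lt[|_ [q Eq <-] qx]; last by exists q.
  by exists (ratr q0), q0.
move=> [q qx Eq]; apply: le_lt_trans qx; apply: ge_inf; last by exists q.
exists (ratr r) => _ [q' Eq' <-]; rewrite ler_rat.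
by rewrite leNgt; apply/negP => /ltW/ndE sub; exact/Er/sub.
Qed.

Let mU (x : R) : measurable (\bigcup_(q in [set q | ratr q < x]) E q).
Proof.
rewrite bigcup_mkcond; apply: bigcupT_measurable_rat => q.
by case: ifP.
Qed.

Lemma measurable_quantile : measurable_fun setT quantile.
Proof.
apply/(measurable_restrict _ mG) => //.
rewrite setTI => _.
apply: (measurability _ (RGenInftyO.measurableE R)) => //.
move=> _ [_ [x ->] <-].
rewrite (_ : _ `&` _ = G `&` \bigcup_(q in [set q | ratr q < x]) E q).
  exact: measurableI.
apply/seteqP; split=> z [Gz] /=.
  have := quantile_lt x Gz; rewrite /quantile patchE mem_set//.
  by rewrite in_itv/= => qq /qq[q qx Eq]; split => //; exists q.
move=> [q qx Eq]; split=> //; rewrite in_itv/=.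
have := quantile_lt x Gz; rewrite /quantile patchE mem_set// => qq.
by apply/qq; exists q.
Qed.

(** It suffices to compare both sides on products of a measurable set with an open half line []-oo,
    x[]. Each side is then the mass of an increasing union over rationals [q < x], and [KE] matches
    the masses level by level. *)
Lemma quantile_disintegration A : measurable A ->
  mu A = (marginal mu \x unit_uniform R)%E [set z | A (z.1, quantile z)].
Proof.
move=> mA.
have mPhi : measurable_fun setT (fun z : S * R => (z.1, quantile z)).
  by apply: measurable_fun_pair => //; exact: measurable_quantile.
pose Phi : {mfun (S * R)%type >-> (S * R)%type} :=
  HB.pack (fun z : S * R => (z.1, quantile z)) (isMeasurableFun.Build _ _ _ _ _
    mPhi).
transitivity (distribution K Phi A); last by [].
move: A mA; apply: (@eq_probability_rectangles _ _ _ _ _ _ _ (@RGenInftyO.G R)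
  (fun n => `]-oo, n%:R[%classic)).
- exact: RGenInftyO.measurableE.
- move=> _ _ [x ->] [y ->]; exists (Num.min x y).
  by apply/seteqP; split=> z /=; rewrite !in_itv/= lt_min;
    [case=> -> ->|case/andP].
- by move=> n; exists n%:R.
- apply/seteqP; split=> // y _; exists (Num.truncn `|y|).+1 => //=.
  by rewrite in_itv/= (le_lt_trans (ler_norm y))// truncnS_gt.
move=> A _ mA [x ->].
(* Up to the null complement of [G], [W] is the event that the first coordinate lies in [A] and the
   quantile is below [x]. *)
pose W := \bigcup_(q in [set q | ratr q < x]) ((A `*` setT) `&` E q).
have mAT : measurable (A `*` @setT R) by exact: measurableX.
have WE : W = (A `*` setT) `&` \bigcup_(q in [set q | ratr q < x]) E q.
  by rewrite setI_bigcupr.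
have mWx : measurable W by rewrite WE; exact: measurableI.
transitivity (K W); last first.
  rewrite KIG//; have mPA : measurable (Phi @^-1` (A `*` `]-oo, x[)).
    by apply: measurable_funPTI; exact: measurableX.
  rewrite [RHS](KIG mPA); congr (K _); rewrite WE.
  apply/seteqP; split=> [[h u] [[[Ah _] [q qx Eq]] Gz]|[h u] [[/= Ah]]].
    by split => //; split => //=; rewrite in_itv/=; apply/quantile_lt => //;
      exists q.
  rewrite in_itv/= => /quantile_lt + Gz => /(_ Gz)[q qx Eq].
  by split => //; split => //; exists q.
apply/eqP; rewrite eq_le; apply/andP; split; last first.
  apply: bigcup_chain_le; [| |exact: measure_ge0|].
  - by move=> q; exact: measurableI.
  - move=> q r qx rx; have [qr|qr] := chE qx rx; [left|right]; exact: setIS.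
  - move=> q qx; rewrite [leLHS](KE q mA); apply: le_measure; rewrite ?inE//;
      [exact: measurableX..|].
    move=> [h y] [/= Ah]; rewrite in_itv/= => yq; split => //=.
    by rewrite in_itv/= (le_lt_trans yq).
rewrite (_ : A `*` `]-oo, x[ = \bigcup_(q in [set q |
  ratr q < x]) (A `*` `]-oo, ratr q])).
  apply: bigcup_chain_le; [| |exact: measure_ge0|].
  - by move=> q; exact: measurableX.
  - by move=> q r _ _; exact: chX.
  - move=> q qx; apply: (@le_trans _ _ (K ((A `*` setT) `&` E q))).
      by rewrite [leRHS](KE q mA).
    apply: le_measure; rewrite ?inE//.
      exact: measurableI.
    by move=> z Ez; exists q.
apply/seteqP; split=> [[h y] [/= Ah]|[h y] [q /= qx] [/= Ah]];
  rewrite !in_itv/=.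
  move=> yx; have [q] := rat_in_itvoo yx; rewrite in_itv/= => /andP[yq qx].
  by exists q => //; split => //=; rewrite in_itv/= ltW.
by move=> yq; split => //=; exact: le_lt_trans qx.
Qed.

End quantile.

(** * Disintegration of laws of real tuples *)

Section disintegration.
Context {R : realType}.

(* The law of (h, Q (h, u)) is mu when h has the first marginal of mu and u is
   an independent variable with law lam; in other words, the image of lam under
   Q (h, _) is a regular conditional distribution of the second coordinate. *)
Definition disintegrates d d' dU (S : measurableType d) (Y : measurableType d')
    (U : measurableType dU) (mu : probability (S * Y)%type R)
    (lam : probability U R) (Q : S * U -> Y) :=
  measurable_fun setT Q /\
  forall A, measurable A ->
    mu A = (marginal mu \x lam)%E [set z | A (z.1, Q z)].

Lemma ge0_integral_disintegrates d d' dU (S : measurableType d)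
    (Y : measurableType d') (U : measurableType dU)
    (mu : probability (S * Y)%type R) (lam : probability U R) (Q : S * U -> Y)
    (f : S * Y -> \bar R) :
    disintegrates mu lam Q -> measurable_fun setT f -> (forall z, 0 <= f z)%E ->
  (\int[mu]_z f z = \int[marginal mu]_h \int[lam]_u f (h, Q (h, u)))%E.
Proof.
move=> [mQ muQ] mf f0.
have mPhi : measurable_fun setT (fun z : S * U => (z.1, Q z)).
  exact: measurable_fun_pair.
pose Phi : {mfun (S * U)%type >-> (S * Y)%type} :=
  HB.pack (fun z : S * U => (z.1, Q z)) (isMeasurableFun.Build _ _ _ _ _ mPhi).
rewrite (eq_measure_integral (distribution (marginal mu \x lam)%E Phi));
  last first.
  by move=> A mA _; exact: muQ.
rewrite ge0_integral_pushforward//= fubini_tonelli1//.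
exact: measurableT_comp.
Qed.

Lemma disintegrates_ae d d' dU (S : measurableType d)
    (Y : measurableType d') (U : measurableType dU)
    (mu : probability (S * Y)%type R) (lam : probability U R) (Q : S * U -> Y)
    (N : set (S * Y)) :
    disintegrates mu lam Q -> measurable N -> mu N = 0%E ->
  {ae marginal mu, forall h, lam [set u | N (h, Q (h, u))] = 0%E}.
Proof.
move=> [mQ muQ] mN muN0.
have mPhi : measurable_fun setT (fun z : S * U => (z.1, Q z)).
  exact: measurable_fun_pair.
have mN' : measurable [set z : S * U | N (z.1, Q z)].
  by rewrite -[X in measurable X]setTI; exact: mPhi.
pose g := (lam \o xsection [set z : S * U | N (z.1, Q z)])%E.
have mg : measurable_fun setT g by exact: measurable_fun_xsection.
have /(ae_eq_integral_abs _ measurableT mg) :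
    (\int[marginal mu]_h `|g h|)%E = 0%E.
  by under eq_integral do rewrite gee0_abs//; rewrite -muN0 muQ.
apply: filterS => h /(_ I)/= gh; rewrite -[RHS]gh /g/=; congr (lam _).
by apply/seteqP; split=> u; rewrite /xsection/= inE.
Qed.

Lemma real_disintegration d (S : measurableType d)
    (mu : probability (S * R)%type R) :
  exists Q : S * R -> R, disintegrates mu (unit_uniform R) Q.
Proof.
have [F [mF F01 ndF muF]] := conditional_cdf mu.
exists (quantile F); split; first exact: measurable_quantile.
exact: (quantile_disintegration mF F01 ndF muF).
Qed.

(** Induction on the length: draw the first entry given [h] by the quantile transform, then the
    remaining entries given [h] and the first entry, with independent sources of randomness. *)
Lemma tuple_disintegration n : forall d (S : measurableType d)
    (mu : probability (S * n.-tuple R)%type R),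
  exists dU (U : measurableType dU) (lam : probability U R)
    (Q : S * U -> n.-tuple R), disintegrates mu lam Q.
Proof.
elim: n => [|n IH] d S mu.
  exists _, R, (unit_uniform R), (fun=> [tuple]); split => // A mA.
  have mA0 : measurable [set h | A (h, [tuple])].
    rewrite -[X in measurable X]setTI.
    by apply: (measurable_fun_pair (f := id) (g := cst [tuple] : S ->
      0.-tuple R)).
  transitivity (marginal mu [set h | A (h, [tuple])]).
    rewrite /marginal /= /distribution /pushforward; congr (mu _).
    by apply/seteqP; split=> -[h y] /=; rewrite (tuple0 y).
  rewrite (_ : [set z | _] = [set h | A (h, [tuple])] `*` setT).
    by rewrite product_measure1E// [X in (_ * X)%E]probability_setT mule1.
  by apply/seteqP; split=> -[h u] //= [].
have mhd : measurable_fun setT (fun z : S * n.+1.-tuple R => (z.1, thead z.2)).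
  apply: measurable_fun_pair => //.
  by apply: (measurableT_comp (measurable_tnth ord0)).
have mhb : measurable_fun setT (fun z : S * n.+1.-tuple R =>
    ((z.1, thead z.2), [tuple of behead z.2])).
  apply: measurable_fun_pair => //.
  exact: (measurableT_comp (@measurable_behead _ _ _)).
pose hd : {mfun (S * n.+1.-tuple R)%type >-> (S * R)%type} :=
  HB.pack (fun z : S * n.+1.-tuple R => (z.1, thead z.2))
    (isMeasurableFun.Build _ _ _ _ _ mhd).
pose hb : {mfun (S * n.+1.-tuple R)%type >-> ((S * R) * n.-tuple R)%type} :=
  HB.pack (fun z : S * n.+1.-tuple R => ((z.1, thead z.2), [tuple of behead
    z.2]))
    (isMeasurableFun.Build _ _ _ _ _ mhb).
have [Q1 dQ1] := real_disintegration (distribution mu hd).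
have [dU [U [lam [Q2 dQ2]]]] := IH _ _ (distribution mu hb).
have [mQ1 _] := dQ1; have [mQ2 muQ2] := dQ2.
exists _, (R * U)%type, (unit_uniform R \x lam)%E,
  (fun z => let r := Q1 (z.1, z.2.1) in [tuple of r :: Q2 ((z.1, r), z.2.2)]).
have mQ : measurable_fun setT (fun z : S * (R * U) =>
   let r := Q1 (z.1, z.2.1) in [tuple of r :: Q2 ((z.1, r), z.2.2)]).
  have mr : measurable_fun setT (fun z : S * (R * U) => Q1 (z.1, z.2.1)).
    apply: measurableT_comp => //; apply: measurable_fun_pair => //.
    exact: measurableT_comp.
  apply: measurable_cons => //; apply: measurableT_comp => //.
  apply: measurable_fun_pair; last exact: measurableT_comp.
  exact: measurable_fun_pair.
split=> // A mA.
pose A' : set ((S * R) * n.-tuple R) := 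
  [set z : (S * R) * n.-tuple R | A (z.1.1, [tuple of z.1.2 :: z.2])].
have mA' : measurable A'.
  rewrite -[X in measurable X]setTI.
  apply: (measurable_fun_pair (f := fun z : (S * R) * n.-tuple R => z.1.1)
     (g := fun z : (S * R) * n.-tuple R => [tuple of z.1.2 :: z.2])) => //.
    exact: measurableT_comp.
  by apply: measurable_cons => //; exact: measurableT_comp.
transitivity (distribution mu hb A').
  have eta (y : n.+1.-tuple R) : [tuple of thead y :: [tuple of behead y]] = y.
    by apply/val_inj; rewrite [in RHS](tuple_eta y).
  rewrite /distribution /pushforward; congr (mu _); apply/seteqP.
  by split=> -[h y]; rewrite /A' /= eta.
rewrite muQ2//.
pose phi (z : S * R) := lam [set u | A' (z, Q2 (z, u))].
have mB : measurable [set z : (S * R) * U | A' (z.1, Q2 z)].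
  by rewrite -[X in measurable X]setTI; exact: measurable_fun_pair.
have mphi : measurable_fun setT phi.
  have := measurable_fun_xsection lam mB.
  apply: eq_measurable_fun => z _ /=; congr (lam _).
  by apply/seteqP; split=> u; rewrite /xsection/= inE.
(* The first marginal of the law of [hb] is the law of [hd]. *)
transitivity (\int[distribution mu hd]_z phi z)%E.
  rewrite /= /product_measure1.
  rewrite (eq_measure_integral (distribution mu hd)) => [|D mD _]; last by [].
  apply: eq_integral => z _ /=; congr (lam _).
  by apply/seteqP; split=> u; rewrite /xsection/= inE.
rewrite (ge0_integral_disintegrates dQ1)//.
rewrite [RHS]/= /product_measure1.
rewrite (eq_measure_integral (marginal mu)) => [|D mD _]; last by [].
apply: eq_integral => h _ /=; rewrite /product_measure1.
apply: eq_integral => u _ /=; congr (lam _).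
by apply/seteqP; split=> u' Hu';
  [exact/mem_set/mem_set|exact: set_mem (set_mem Hu')].
Qed.
End disintegration.

(** * Conditional expectations as finite convex combinations *)

Section convex_combination.
Context {R : realType}.

(** Apply [zero_combination] to the centred functions on the complement of [N], then divide the
    weights by their positive sum. *)
Lemma convex_combination m d (Y : measurableType d) (mu : probability Y R)
    (N : set Y) (phi : 'I_m -> Y -> R) :
    measurable N -> mu N = 0%E ->
    (forall i, mu.-integrable setT (EFin \o phi i)) ->
  exists (J : finType) (w : J -> R) (y : J -> Y),
    [/\ forall j, 0 <= w j, \sum_j w j = 1, forall j, ~ N (y j) &
        forall i, ((\sum_j w j * phi i (y j))%:E = \int[mu]_y (phi i y)%:E)%E].
Proof.
move=> mN N0 iphi.
have mNC : measurable (~` N) by exact: measurableC.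
have NC1 : mu (~` N) = 1%E by rewrite probability_setC// N0 sube0.
pose c i := fine (\int[mu]_y (phi i y)%:E).
have cE i : (\int[mu]_y (phi i y)%:E)%E = (c i)%:E.
  by rewrite /c fineK//; exact: integrable_fin_num (iphi i).
have icst i : mu.-integrable setT (EFin \o cst (c i)).
  exact: finite_measure_integrable_cst.
have idiff i : mu.-integrable setT (EFin \o (fun y => phi i y - c i)).
  by apply: eq_integrable (integrableB measurableT (iphi i) (icst i)).
have [||i|i|J [w [y [w0 w1 Ny phi0]]]] := @zero_combination R m _ Y mu (~` N)
    (fun i y => phi i y - c i).
- exact: mNC.
- by rewrite NC1 onee_eq0.
- by apply: integrableS (idiff i).
- transitivity (\int[mu]_y (phi i y - c i)%:E)%E.
    by rewrite -setTD [RHS](negligible_integral mN measurableT (idiff i) N0).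
  under eq_integral do rewrite EFinB.
  rewrite (integralB_EFin measurableT (iphi i) (icst i)) cE.
  have := integral_cst mu measurableT (c i)%:E.
  rewrite [X in (_ * X)%E]probability_setT mule1 => ->.
  by rewrite subee.
exists J, (fun j => w j / \sum_k w k), y; split => //.
- by move=> j; rewrite divr_ge0// ltW.
- by rewrite -mulr_suml divff// gt_eqF.
move=> i; rewrite cE; congr (_%:E); apply/eqP; rewrite -subr_eq0; apply/eqP.
transitivity ((\sum_j w j * (phi i (y j) - c i)) / \sum_k w k); last first.
  by rewrite phi0 mul0r.
rewrite mulr_suml; under [RHS]eq_bigr do rewrite mulrBr mulrBl.
rewrite sumrB; congr (_ - _); first by apply: eq_bigr => j _; rewrite mulrAC.
by rewrite -mulr_suml -mulr_suml mulrAC divff ?mul1r// gt_eqF.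
Qed.

End convex_combination.

Section conditional_version.
Context {R : realType} d d' (S : measurableType d) (Y : measurableType d').
Variable mu : probability (S * Y)%type R.

Definition conditional_version (phi : S * Y -> R) (c : S -> R) :=
  (marginal mu).-integrable setT (EFin \o c) /\
  forall A, measurable A ->
    (\int[mu]_(z in A `*` setT) (phi z)%:E = \int[marginal mu]_(h in A) (c
      h)%:E)%E.

Context dU (U : measurableType dU).
Variables (lam : probability U R) (Q : S * U -> Y).
Hypothesis dQ : disintegrates mu lam Q.

Let mPhi : measurable_fun setT (fun z : S * U => (z.1, Q z)).
Proof. by have [mQ _] := dQ; exact: measurable_fun_pair. Qed.

Let Phi : {mfun (S * U)%type >-> (S * Y)%type} :=
  HB.pack (fun z : S * U => (z.1, Q z)) (isMeasurableFun.Build _ _ _ _ _ mPhi).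

Let muE A : measurable A -> mu A = distribution (marginal mu \x lam)%E Phi A.
Proof. by have [_ muQ] := dQ; exact: muQ. Qed.

Variable phi : S * Y -> R.
Hypothesis iphi : mu.-integrable setT (EFin \o phi).

Let mphi : measurable_fun setT (EFin \o phi).
Proof. exact: (measurable_int mu). Qed.

Let iK : (marginal mu \x lam)%E.-integrable setT (EFin \o phi \o Phi).
Proof.
apply/integrableP; split; first exact: measurableT_comp.
move/integrableP : iphi => [_]; apply: le_lt_trans.
rewrite (eq_measure_integral (distribution (marginal mu \x lam)%E Phi));
  last first.
  by move=> A mA _; exact: muE.
by rewrite ge0_integral_pushforward//; exact: measurableT_comp.
Qed.

Lemma conditional_integral (A : set S) : measurable A ->
  (\int[mu]_(z in A `*` setT) (phi z)%:E =
   \int[marginal mu]_(h in A) \int[lam]_u (phi (h, Q (h, u)))%:E)%E.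
Proof.
move=> mA.
have mAT : measurable (A `*` @setT Y) by exact: measurableX.
rewrite (eq_measure_integral (distribution (marginal mu \x lam)%E Phi));
  last first.
  by move=> B mB _; exact: muE.
rewrite integral_pushforward//; last first.
  by apply: (integrableS measurableT) => //; exact: measurable_funPTI.
have mA' : measurable (Phi @^-1` (A `*` setT)) by exact: measurable_funPTI.
rewrite integral_mkcond -integral12_prod_meas1; last first.
  by apply/(integrable_mkcond _ mA'); apply: integrableS iK.
rewrite [RHS]integral_mkcond; apply: eq_integral => h _.
rewrite /fubini_F [RHS]patchE; case: ifPn => hA.
  by apply: eq_integral => u _; rewrite patchE mem_set//; split => //;
    exact: set_mem.
rewrite integral0_eq// => u _; rewrite patchE memNset//= => -[/mem_set].
by rewrite (negbTE hA).
Qed.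

(** The integral over [u] is such a version once it is replaced by 0 on the null set where it is not
    finite. *)
Lemma exists_conditional_version : exists c, conditional_version phi c.
Proof.
have iF := integrable_fubini_F iK.
pose C h := (\int[lam]_u (phi (h, Q (h, u)))%:E)%E.
have [N [mN N0 sN]] := integrable_ae measurableT iF.
have CN h : ~ N h -> C h \is a fin_num.
  by move=> Nh; apply: contrapT => Ch; apply: Nh; apply: sN => /(_ I).
exists (fun h => fine ((C \_ (~` N)) h)); split.
  have : (marginal mu).-integrable setT (C \_ (~` N)).
    apply/(integrable_mkcond _ (measurableC mN)).
    by apply: integrableS iF => //; exact: measurableC.
  apply: eq_integrable => // h _ /=; rewrite fineK// patchE.
  by case: ifPn => // /set_mem; exact: CN.
move=> A mA; rewrite conditional_integral//; apply: ae_eq_integral => //.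
- by apply: measurable_funTS; exact: (measurable_int _ iF).
- apply: measurable_funTS; apply/measurable_EFinP;
    apply: measurableT_comp => //.
  apply/measurable_restrict => //; first exact: measurableC.
  by rewrite setTI; apply: measurable_funTS; exact: (measurable_int _ iF).
- exists N; split=> // h /= gh; apply: contrapT => Nh; apply: gh => _.
  by rewrite patchE mem_set// fineK//; exact: CN.
Qed.

(** The version is arbitrary because, for the coordinates of the next position, the martingale
    property provides one of its own: the current position. *)
Lemma ae_conditional_version (c : S -> R) : conditional_version phi c ->
  {ae marginal mu, forall h,
    lam.-integrable setT (fun u => (phi (h, Q (h, u)))%:E) /\
    (\int[lam]_u (phi (h, Q (h, u)))%:E = (c h)%:E)%E}.
Proof.
move=> [ic cE]; apply: filterI; first exact: ae_integrable1 iK.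
have : ae_eq (marginal mu) setT (fun h => \int[lam]_u (phi (h, Q (h, u)))%:E)%E
  (EFin \o c).
  apply: integral_ae_eq => //; first exact: (integrable_fubini_F iK).
    exact: (measurable_int _ ic).
  by move=> A _ mA; rewrite -cE// conditional_integral.
by apply: filterS => h; exact.
Qed.

End conditional_version.

Section conditional_combination.
Context {R : realType} d d' (S : measurableType d) (Y : measurableType d').
Variable mu : probability (S * Y)%type R.
Context dU (U : measurableType dU).
Variables (lam : probability U R) (Q : S * U -> Y).

(** For almost every [h], the variable [Q (h, _)] almost surely avoids the section of [N], and its
    [phi i] have means [c i h]; [convex_combination] is applied for each such [h] separately. *)
Lemma ae_conditional_combination m (N : set (S * Y))
    (phi : 'I_m -> S * Y -> R) (c : 'I_m -> S -> R) :
    disintegrates mu lam Q -> measurable N -> mu N = 0%E ->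
    (forall i, mu.-integrable setT (EFin \o phi i)) ->
    (forall i, conditional_version mu (phi i) (c i)) ->
  {ae marginal mu, forall h, exists (J : finType) (w : J -> R) (y : J -> Y),
    [/\ forall j, 0 <= w j, \sum_j w j = 1, forall j, ~ N (h, y j) &
        forall i, \sum_j w j * phi i (h, y j) = c i h]}.
Proof.
move=> dQ mN N0 iphi cphi; have [mQ _] := dQ.
have aec : {ae marginal mu, forall h i,
    lam.-integrable setT (fun u => (phi i (h, Q (h, u)))%:E) /\
    (\int[lam]_u (phi i (h, Q (h, u)))%:E = (c i h)%:E)%E}.
  by apply: ae_forall_countable => i;
    exact: (ae_conditional_version dQ (iphi i) (cphi i)).
have aeN := disintegrates_ae dQ mN N0.
apply: filterS2 aec aeN => h ch Nh.
have mNh : measurable [set u | N (h, Q (h, u))].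
  rewrite -[X in measurable X]setTI.
  apply: (measurable_fun_pair (f := cst h) (g := fun u => Q (h, u))) => //.
  by apply: measurableT_comp => //; exact: measurable_fun_pair.
have [J [w [u [w0 w1 Nu wphi]]]] := convex_combination mNh Nh
  (phi := fun i u => phi i (h, Q (h, u))) (fun i => (ch i).1).
exists J, w, (fun j => Q (h, u j)); split => // i.
by apply/EFin_inj; rewrite -(ch i).2 -wphi.
Qed.

End conditional_combination.

(** * Simple martingales *)

Section stopped_paths.
Context {R : realType} {n T : nat}.
Local Notation path := (path_space R n T).
Implicit Types (x h : path) (y : euclidean R n).

(* Freezing paths at time t lets histories of all lengths live in path. *)
Definition stop (t : nat) x : path := [tuple tnth x (inord (minn s t)) |
  s < T.+1].

(** All times after [t] receive the position [y], so the result is already frozen at time [t.+1]. *)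
Definition extend (t : nat) x y : path :=
  [tuple if (s <= t)%N then tnth x s else y | s < T.+1].

Lemma tnth_stop t x (s : 'I_T.+1) : (s <= t)%N -> tnth (stop t x) s = tnth x s.
Proof. by move=> st; rewrite tnth_mktuple (minn_idPl st) inord_val. Qed.

Lemma stop_stop s t x : (s <= t)%N -> stop s (stop t x) = stop s x.
Proof.
move=> st; apply/eq_from_tnth => i; rewrite !tnth_mktuple.
have is_ltT : (minn i s < T.+1)%N by rewrite ltnS geq_min -ltnS ltn_ord.
by rewrite (inordK is_ltT) -minnA (minn_idPl st).
Qed.

Lemma stop_ge t x : (T <= t)%N -> stop t x = x.
Proof.
move=> Tt; apply/eq_from_tnth => i; apply: tnth_stop.
by rewrite (leq_trans _ Tt)// -ltnS.
Qed.

Lemma eq_stop t x h (s : 'I_T.+1) : (s <= t)%N ->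
  stop t x = stop t h -> tnth x s = tnth h s.
Proof. by move=> st xh; rewrite -(tnth_stop x st) xh tnth_stop. Qed.

Lemma stop_extend t x y : stop t (extend t x y) = stop t x.
Proof.
apply/eq_from_tnth => i; rewrite !tnth_mktuple.
have it_ltT : (minn i t < T.+1)%N by rewrite ltnS geq_min -ltnS ltn_ord.
by rewrite (inordK it_ltT) geq_minr.
Qed.

Lemma extend_stop t x y : extend t (stop t x) y = extend t x y.
Proof.
apply/eq_from_tnth => i; rewrite [LHS]tnth_mktuple [RHS]tnth_mktuple.
by case: ifPn => // /tnth_stop.
Qed.

Lemma stop_succ (t : 'I_T.+1) x : (0 < t)%N ->
  stop t x = extend t.-1 x (tnth x t).
Proof.
move=> t0; apply/eq_from_tnth => i; rewrite !tnth_mktuple -ltnS prednK//.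
by case: ltnP => it; rewrite inord_val.
Qed.

End stopped_paths.

Section attainable.
Context {R : realType} {n T : nat}.
Local Notation path := (path_space R n T).
Variable f : path -> \bar R.

(* Under the law sum_j w_j delta_(x_j) the coordinate process continues the
   history of h up to time t as a martingale; the test sets B range over all
   sets, which costs nothing for a finitely supported law. *)
Definition attainable (t : nat) (h : path) (c : R) :=
  exists (J : finType) (w : J -> R) (x : J -> path) (v : J -> R),
  [/\ (forall j, 0 <= w j) /\ \sum_j w j = 1,
      forall j, stop t (x j) = stop t h,
      forall j, ((v j)%:E <= f (x j))%E,
      \sum_j w j * v j = c &
      forall (s u : 'I_T.+1) (i : 'I_n) (B : set path), (t <= s <= u)%N ->
        \sum_j w j * \1_B (stop s (x j)) *
          (tnth (tnth (x j) u) i - tnth (tnth (x j) s) i) = 0].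

Lemma attainable_horizon h c : (c%:E <= f h)%E -> attainable T h c.
Proof.
move=> cf; exists unit, (fun=> 1), (fun=> h), (fun=> c); split => //.
- by split=> //; rewrite big_const card_unit/= addr0.
- by rewrite big_const card_unit/= mul1r addr0.
move=> s u i B /andP[Ts su]; rewrite (_ : u = s) ?subrr.
  by rewrite big1// => j _; rewrite mulr0.
apply/val_inj/eqP; rewrite eqn_leq su andbT.
exact: leq_trans (leq_ord u) Ts.
Qed.

(** Concatenation: move from [h] to [y j] with probability [w j], then follow a finite law that
    attains [c j] from there. Weights multiply along the branches. *)
Lemma attainable_step (t : nat) (h : path) (J : finType) (w : J -> R)
    (y : J -> euclidean R n) (c : J -> R) :
    (t < T)%N -> (forall j, 0 <= w j) -> \sum_j w j = 1 ->
    (forall i, \sum_j w j * tnth (y j) i = tnth (tnth h (inord t)) i) ->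
    (forall j, attainable t.+1 (extend t h (y j)) (c j)) ->
  attainable t h (\sum_j w j * c j).
Proof.
move=> tT w0 w1 wy att.
have tT1 : (t < T.+1)%N by rewrite ltnS ltnW.
have [K KP] := choice att.
have [wK {}KP] := all_sig (fun j => cid (KP j)).
have [x {}KP] := all_sig (fun j => cid (KP j)).
have [v {}KP] := all_sig (fun j => cid (KP j)).
have wK0 j k : 0 <= wK j k by have [[]] := KP j.
have wK1 j : \sum_k wK j k = 1 by have [[]] := KP j.
have xt j k : stop t (x j k) = stop t h.
  have [_ /(_ k) xE _ _ _] := KP j.
  by rewrite -(@stop_stop _ _ _ t t.+1)// xE stop_stop// stop_extend.
have xt1 j k : tnth (x j k) (inord t.+1) = y j.
  have [_ /(_ k) xE _ _ _] := KP j.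
  have tT2 : (t.+1 < T.+1)%N by [].
  rewrite (@eq_stop _ _ _ _ _ _ _ _ xE) ?inordK//.
  by rewrite tnth_mktuple inordK// ltnn.
have sumE (F : forall j, K j -> R) :
    \sum_(p : {j & K j}) F (tag p) (tagged p) = \sum_j \sum_k F j k.
  by rewrite (sig_big_dep xpredT (fun=> xpredT)).
(* The leaves are dependent pairs because the index set [K j] of a continuation varies with the
   branch [j]. *)
exists {j & K j}, (fun p => w (tag p) * wK (tag p) (tagged p)),
  (fun p => x (tag p) (tagged p)), (fun p => v (tag p) (tagged p)); split.
- split=> [p|]; first exact: mulr_ge0.
  rewrite (sumE (fun j k => w j * wK j k)) -w1.
  by apply: eq_bigr => j _; rewrite -mulr_sumr wK1 mulr1.
- by move=> p; exact: xt.
- by move=> p; have [_ _ + _ _] := KP (tag p); exact.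
- rewrite (sumE (fun j k => w j * wK j k * v j k)); apply: eq_bigr => j _.
  have [_ _ _ <- _] := KP j.
  by rewrite mulr_sumr; apply: eq_bigr => k _; rewrite mulrA.
move=> s u i B /andP[ts su].
rewrite (sumE (fun j k => w j * wK j k * \1_B (stop s (x j k)) *
   (tnth (tnth (x j k) u) i - tnth (tnth (x j k) s) i))).
have sumw j : \sum_k w j * wK j k * \1_B (stop s (x j k)) *
     (tnth (tnth (x j k) u) i - tnth (tnth (x j k) s) i) =
    w j * \sum_k wK j k * \1_B (stop s (x j k)) *
     (tnth (tnth (x j k) u) i - tnth (tnth (x j k) s) i).
  by rewrite mulr_sumr; apply: eq_bigr => k _; rewrite !mulrA.
under eq_bigr do rewrite sumw.
(* After time [t] the martingale identity holds on each branch. At [s = t] the increment is split at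
   time [t.+1]. *)
move: ts; rewrite leq_eqVlt => /orP[/eqP ts|ts]; last first.
  rewrite big1// => j _; have [_ _ _ _ mart] := KP j.
  by rewrite mart ?mulr0// ts.
have [us|us] := eqVneq u s.
  rewrite big1// => j _; rewrite big1 ?mulr0// => k _.
  by rewrite us subrr mulr0.
have su' : (t.+1 <= u)%N by rewrite ts ltn_neqAle su eq_sym andbT.
have sE : s = inord t by apply/val_inj; rewrite /= inordK.
have step j : \sum_k wK j k * (tnth (tnth (x j k) u) i - tnth (y j) i) = 0.
  have [_ _ _ _ mart] := KP j.
  have := mart (inord t.+1) u i setT;
    rewrite inordK// leqnn su' => /(_ isT) m0; rewrite -[RHS]m0.
  by apply: eq_bigr => k _; rewrite indicT mulr1 xt1.
(* All leaves share the history [stop t h], so the indicator is constant. The increment after [t.+1]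
   vanishes on each branch by [step], and the first one averages to 0 by [wy]. *)
transitivity (\sum_j w j * (\1_B (stop t h) * (tnth (y j) i - tnth (tnth h
  (inord t)) i))).
  apply: eq_bigr => j _; congr (_ * _).
  transitivity (\1_B (stop t h) * \sum_k wK j k *
     ((tnth (tnth (x j k) u) i - tnth (y j) i) + (tnth (y j) i - tnth (tnth h
       (inord t)) i))).
    rewrite mulr_sumr; apply: eq_bigr => k _.
    have -> : tnth (x j k) s = tnth h (inord t).
      by rewrite sE; apply: (eq_stop _ (xt j k)); rewrite inordK.
    by rewrite -ts xt addrA subrK mulrCA mulrA.
  under eq_bigr do rewrite mulrDr.
  by rewrite big_split/= step add0r -mulr_suml wK1 mul1r.
under eq_bigr do rewrite mulrCA mulrBr.
rewrite -mulr_sumr sumrB wy -mulr_suml w1 mul1r subrr mulr0//.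
Qed.

End attainable.

Section finite_law.
Context {R : realType} (J : finType) (j0 : J) (w : J -> R).
Hypothesis w0 : forall j, 0 <= w j.
Hypothesis w1 : \sum_j w j = 1.

(** Integers from [#|J|] on are sent to the default [j0]; they carry no mass under the law below. *)
Definition finite_point (k : nat) : J := nth j0 (enum J) k.

(* finite_point has law sum_j w_j delta_j under finite_law; the sample space is
   nat because its sigma-algebra is discrete. *)
Definition finite_law & \sum_j w j = 1 : set nat -> \bar R :=
  msum (fun k => mscale (NngNum (w0 (finite_point k))) \d_k) #|J|.

Local Notation P := (finite_law w1).

HB.instance Definition _ := Measure.on P.

Let sum_finite_point (V : nmodType) (F : J -> V) :
  \sum_(k < #|J|) F (finite_point k) = \sum_j F j.
Proof.
rewrite /finite_point cardE -(big_mkord xpredT (fun k => F (nth j0 (enum J)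
  k))).
by rewrite -(big_nth j0 xpredT) big_enum.
Qed.

Let measurable_fun_nat (D : set nat) (g : nat -> \bar R) : measurable_fun D g.
Proof. by []. Qed.

Let ge0_integral_finite_law (phi : J -> R) : (forall j, 0 <= phi j) ->
  (\int[P]_k (phi (finite_point k))%:E = (\sum_j w j * phi j)%:E)%E.
Proof.
move=> phi0; rewrite ge0_integral_measure_sum//; last first.
  by move=> k _; rewrite lee_fin.
rewrite -(sum_finite_point (fun j => w j * phi j)) -sumEFin.
apply: eq_bigr => k _; rewrite ge0_integral_mscale//; last first.
  by move=> i _; rewrite lee_fin.
by rewrite integral_dirac// diracT mul1e EFinM.
Qed.

Let finite_lawT : P setT = 1%E.
Proof.
have := ge0_integral_finite_law (fun=> ler01).
by rewrite integral_cst// mul1e => ->; under eq_bigr do rewrite mulr1;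
  rewrite w1.
Qed.

HB.instance Definition _ := Measure_isProbability.Build _ _ _ P finite_lawT.

Lemma integral_finite_law (phi : J -> R) :
  (\int[P]_k (phi (finite_point k))%:E = (\sum_j w j * phi j)%:E)%E.
Proof.
rewrite integralE.
transitivity (\int[P]_k (phi^\+ (finite_point k))%:E -
  \int[P]_k (phi^\- (finite_point k))%:E)%E.
  by congr (_ - _)%E; apply: eq_integral => k _; rewrite (funerpos,funerneg).
rewrite !ge0_integral_finite_law// -EFinB -sumrB; congr (_%:E).
apply: eq_bigr => j _; rewrite -mulrBr; congr (_ * _).
by have /(congr1 (@^~ j)) := funrposBneg phi.
Qed.

Lemma integrable_finite_law (phi : J -> R) :
  P.-integrable setT (fun k => (phi (finite_point k))%:E).
Proof.
apply/integrableP; split => //.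
by rewrite (ge0_integral_finite_law (fun j => normr_ge0 (phi j))) ltry.
Qed.

End finite_law.

(** * Universally measurable integrands *)

Lemma rat_between_ereal (R : realType) (x y : \bar R) : (x < y)%E ->
  exists2 q : rat, (x < (ratr q)%:E)%E & ((ratr q)%:E < y)%E.
Proof.
have between (r s : R) : r < s -> exists2 q : rat, r < ratr q & ratr q < s.
  by move=> /rat_in_itvoo[q]; rewrite in_itv/= => /andP[rq qs]; exists q.
case: x => [r| |]; case: y => [s| |]//=.
- by rewrite lte_fin => /between[q rq qs]; exists q; rewrite lte_fin.
- by have [|q rq _ _] := between r (r + 1); [rewrite ltrDl|exists q;
    rewrite ?lte_fin ?ltry].
- by have [|q _ qs _] := between (s - 1) s; [rewrite gtrBl|exists q;
    rewrite ?lte_fin ?ltNyr].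
- by exists 0; rewrite ?ltry ?ltNyr.
Qed.

Section lower_version.
Context d (S : measurableType d) (R : realType).

(** For every rational [q], the set where [f > q] contains a measurable [A q] that fills it up to a
    negligible set, and [g x] is the supremum of the [q] with [x] in [A q]. The bound [g <= f] holds
    everywhere, because it is applied at single points of finite trees. *)
Lemma lower_version (mu : probability S R) (f : S -> \bar R) :
    universally_measurable_fun f ->
  exists g : S -> \bar R, [/\ measurable_fun setT g,
    forall x, (g x <= f x)%E & {ae mu, forall x, f x = g x}].
Proof.
move=> mf.
have /choice[A AP] : forall q : rat, exists A : set S,
    [/\ measurable A, A `<=` [set x | (ratr q)%:E < f x]%E &
        mu.-negligible ([set x | (ratr q)%:E < f x]%E `\` A)].
  move=> q; have mq : measurable [set y : \bar R | ((ratr q)%:E < y)%E].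
    rewrite (_ : mkset _ = `](ratr q)%:E, +oo[%classic);
      first exact: emeasurable_itv.
    by apply/seteqP; split=> y /=; rewrite in_itv/= andbT.
  have [B mB [N NN /= BN]] := mf _ mq mu.
  exists B; split => //; first by move=> x Bx; rewrite -[X in X x]BN; left.
  apply: negligibleS NN => x [/= fx Bx].
  by have [] : (B `|` N) x by rewrite BN.
pose g x : \bar R := ereal_sup [set (ratr q : R)%:E | q in [set q | A q x]].
have gP (y : \bar R) x :
    (y < g x)%E <-> exists2 q, (y < (ratr q : R)%:E)%E & A q x.
  split=> [/ereal_sup_gt[_ [q Aq <-] yq]|[q yq Aq]]; first by exists q.
  by apply: lt_le_trans yq _; apply: ereal_sup_ubound; exists q.
exists g; split.
- apply: (measurability _ (ErealGenOInfty.measurableE R)).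
  move=> _ [_ [y ->] <-]; rewrite setTI.
  rewrite (_ : _ @^-1` _ = \bigcup_(q in [set q | y < ratr q]) A q).
    rewrite bigcup_mkcond; apply: bigcupT_measurable_rat => q.
    by case: ifP => // _; have [] := AP q.
  apply/seteqP; split=> x /=; rewrite in_itv/= andbT.
    by move=> /gP[q yq Aq]; exists q.
  by move=> [q yq Aq]; apply/gP; exists q.
- move=> x; apply: ge_ereal_sup => _ [q Aq <-]; apply/ltW.
  by have [_ sA _] := AP q; exact: sA.
have : {ae mu, forall x, forall q : rat, ((ratr q)%:E < f x)%E -> A q x}.
  apply: ae_forall_countable => q; have [_ _] := AP q.
  by apply: negligibleS => x /= /not_implyP[].
apply: filterS => x Ax; apply/eqP; rewrite eq_le; apply/andP; split; last first.
  apply: ge_ereal_sup => _ [q Aq <-]; apply/ltW.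
  by have [_ sA _] := AP q; exact: sA.
rewrite leNgt; apply/negP => gf.
have [q gq /Ax Aq] := rat_between_ereal gf.
by have := ltxx (g x); have -> // : (g x < g x)%E; apply/gP; exists q.
Qed.

(** Change of variables is applied to a measurable version of [f]; the exceptional null set pulls
    back along [X] to a null set. *)
Lemma integral_law d' (Omega : measurableType d') (P : probability Omega R)
    (X : Omega -> S) (mu : probability S R) (f : S -> \bar R) :
    universally_measurable_fun f -> measurable_fun setT X ->
    (forall A, measurable A -> mu A = pushforward P X A) ->
  (\int[mu]_x f x = \int[P]_w f (X w))%E.
Proof.
move=> mf mX muE.
pose X' : {mfun Omega >-> S} := HB.pack X (isMeasurableFun.Build _ _ _ _ _ mX).
have [g [mg gf fg]] := lower_version mu mf.
have ge0E (h : S -> \bar R) : (forall x, 0 <= h x)%E -> measurable_fun setT h ->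
    (\int[mu]_x h x = \int[P]_w h (X w))%E.
  move=> h0 mh; rewrite (eq_measure_integral (distribution P X')); last first.
    by move=> A mA _; exact: muE.
  by rewrite ge0_integral_pushforward.
rewrite (integral_version mg fg).
transitivity (\int[P]_w g (X w))%E.
  rewrite integralE [RHS]integralE; congr (_ - _)%E.
    rewrite ge0E//; last exact: measurable_funepos.
    by apply: eq_integral => w _; rewrite !funeposE.
  rewrite ge0E//; last exact: measurable_funeneg.
  by apply: eq_integral => w _; rewrite !funenegE.
apply/esym/integral_version; first exact: measurableT_comp.
have [N [mN N0 sN]] := fg.
exists (X @^-1` N); split.
- exact: (measurable_funPTI X').
- by rewrite -N0 muE.
- by move=> w /= fgw; exact: sN.
Qed.

End lower_version.

Section simple_martingale.
Context {R : realType} {n T : nat}.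
Local Notation path := (path_space R n T).

Lemma attainable_simple_martingale (f : path -> \bar R) (h : path) (c : R) :
    universally_measurable_fun f -> attainable f 0 h c ->
  exists2 mu, simple_martingale_laws T (tnth h ord0) mu &
    (c%:E <= \int[mu]_x f x)%E.
Proof.
move=> mf [J [w [x [v [[w0 w1] xh vf wv mart]]]]].
have [j0 _|J0] := pickP (fun _ : J => true); last first.
  move: w1; rewrite big1 => [/eqP|j _]; first by rewrite eq_sym oner_eq0.
  by have := J0 j.
pose e := finite_point j0; pose P : probability nat R := finite_law j0 w0 w1.
have PE (phi : J -> R) : (\int[P]_k (phi (e k))%:E = (\sum_j w j * phi j)%:E)%E.
  exact: integral_finite_law.
have iP (phi : J -> R) : P.-integrable setT (fun k => (phi (e k))%:E).
  exact: integrable_finite_law.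
pose M (t : 'I_T.+1) (k : nat) : euclidean R n := tnth (x (e k)) t.
(* Events at time [t] are those determined by the path stopped at [t]. Arbitrary [B] are allowed
   since every subset of [nat] is measurable, which matches the test sets in [attainable]. *)
pose F (t : 'I_T.+1) : set (set nat) :=
  [set (fun k => stop t (x (e k))) @^-1` B | B in [set: set path]].
have FM t (B : set (euclidean R n)) : F t (M t @^-1` B).
  exists [set y | B (tnth y t)] => //; apply/seteqP.
  by split=> k; rewrite /M/= tnth_stop.
have path_ofE k : path_of M k = x (e k).
  by apply/eq_from_tnth => t; rewrite tnth_mktuple.
have mM : measurable_fun setT (path_of M) by [].
pose X : {mfun nat >-> path} := HB.pack (path_of M) (isMeasurableFun.Build _ _
  _ _ _ mM).
exists (distribution P X); last first.
  rewrite (integral_law (P := P) mf mM)//.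
  under eq_integral do rewrite path_ofE.
  have ivf : P.-integrable setT (fun k => (v (e k))%:E) by exact: iP.
  rewrite -wv -(PE v) [leLHS]integralE [leRHS]integralE.
  (* Positive and negative parts are compared separately, as [f] may take infinite values. *)
  apply: leeB; apply: ge0_le_integral => //.
  - by move=> k _; rewrite !funeposE le_max2// vf.
  - by move=> k _; rewrite !funenegE le_max2// leeN2 vf.
exists _, nat, P, F, M; split => //.
- split=> [|t B _|t i|s t st i].
  + split=> [t|s t st _ [B _ <-]].
      split=> //; split.
      * by exists set0.
      * by move=> _ [B _ <-]; exists (~` B) => //; rewrite setTD.
      * move=> A FA; have /choice[B BA] k :
          exists B, (fun k => stop t (x (e k))) @^-1` B = A k.
          by have [B _ <-] := FA k; exists B.
        by exists (\bigcup_k B k) => //; rewrite preimage_bigcup;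
          under eq_bigcupr do rewrite BA.
    exists (stop s @^-1` B) => //; apply/seteqP.
    by split=> k /=; rewrite stop_stop.
  + exact: FM.
  + exact: (iP (fun j => tnth (tnth (x j) t) i)).
  + split.
    * by move=> B _; exact: (FM s [set y | B (tnth y i)]).
    * exact: (iP (fun j => tnth (tnth (x j) s) i)).
    * move=> _ [B _ <-].
      have intF (t' : 'I_T.+1) : (\int[P]_(k in (fun k => stop s (x (e k)))
        @^-1` B)
          (component (M t') i k)%:E =
          (\sum_j w j * (\1_B (stop s (x j)) * tnth (tnth (x j) t') i))%:E)%E.
        rewrite -PE integral_mkcond; apply: eq_integral => k _.
        rewrite patchE indicE; case: ifPn => [/set_mem kB|kB].
          by rewrite mem_set// mul1r.
        by rewrite memNset ?mul0r//; move: kB; rewrite notin_setE.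
      rewrite !intF; congr (_%:E); apply/esym/eqP; rewrite -subr_eq0 -sumrB.
      rewrite -[X in _ == X](mart s t i B) ?st//; apply/eqP/eq_bigr => j _.
      by rewrite -mulrBr -mulrBr mulrA.
- apply: aeW => k; rewrite /M; apply: eq_stop (xh _).
  by [].
- move=> t; apply: (@sub_finite_set _ _ [set tnth (x j) t | j in [set: J]]).
    by move=> _ [k _ <-]; exists (e k).
  exact: finite_image.
Qed.

End simple_martingale.

(** * Backward induction along a martingale *)

Lemma integrable_distribution d d' (X : measurableType d) (Y :
  measurableType d')
    (R : realType) (P : probability X R) (Z : {mfun X >-> Y})
    (g : Y -> \bar R) :
    measurable_fun setT g -> P.-integrable setT (g \o Z) ->
  (distribution P Z).-integrable setT g.
Proof.
move=> mg /integrableP[_ ig]; apply/integrableP; split => //.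
rewrite ge0_integral_pushforward//; exact: measurableT_comp.
Qed.

Section measurable_paths.
Context {R : realType} {n T : nat}.
Local Notation path := (path_space R n T).

Lemma measurable_stop t : measurable_fun setT (@stop R n T t).
Proof.
apply/measurable_fun_tnthP => i.
rewrite (_ : _ \o _ = (@tnth _ _)^~ (inord (minn i t)));
  first exact: measurable_tnth.
by apply/funext => x /=; rewrite tnth_mktuple.
Qed.

Lemma measurable_extend t : measurable_fun setT
  (fun z : path * euclidean R n => extend t z.1 z.2).
Proof.
apply/measurable_fun_tnthP => i.
rewrite (_ : _ \o _ = fun z : path * euclidean R n =>
    if (i <= t)%N then tnth z.1 i else z.2).
  case: (i <= t)%N; last exact: measurable_snd.
  exact: (measurableT_comp (measurable_tnth i) measurable_fst).
by apply/funext => z /=; rewrite tnth_mktuple.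
Qed.

End measurable_paths.

Section adapted.
Context {d} {Omega : measurableType d} {R : realType} {n T : nat}.
Variables (P : probability Omega R) (F : 'I_T.+1 -> set (set Omega)).
Variable M : 'I_T.+1 -> Omega -> euclidean R n.
Hypothesis mart : martingale P F M.

Lemma measurable_path_of : measurable_fun setT (path_of M).
Proof.
have [[filt _] adapt _ _] := mart.
apply/measurable_fun_tnthP => t.
have -> : (@tnth _ _)^~ t \o path_of M = M t.
  by apply/funext => w /=; rewrite tnth_mktuple.
by move=> _ B mB; rewrite setTI; apply: (filt t).2; exact: adapt.
Qed.

Lemma adapted_stop (s : 'I_T.+1) :
  sub_measurable (F s) (stop s \o path_of M).
Proof.
have [[filt mono] adapt _ _] := mart.
have mF : <<s F s>> = F s by apply: sigma_algebra_id; exact: (filt s).1.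
(* Taking [F s] as the sigma-algebra of the sample space allows a check coordinate by coordinate:
   each entry of the stopped path is [M] at a time at most [s]. *)
have : measurable_fun setT
    (stop s \o path_of M : g_sigma_algebraType (F s) -> path_space R n T).
  apply/measurable_fun_tnthP => i.
  have iT : (minn i s < T.+1)%N by rewrite ltnS geq_min -ltnS ltn_ord.
  have -> : (@tnth _ _)^~ i \o (stop s \o path_of M) = M (inord (minn i s)).
    by apply/funext => w /=; rewrite !tnth_mktuple.
  move=> _ B mB; rewrite setTI /measurable/= mF;
    apply: (mono (inord (minn i s))).
    by rewrite inordK// geq_minr.
  exact: adapt.
by move=> mstop B mB; have := mstop measurableT B mB;
  rewrite setTI /measurable/= mF.
Qed.

End adapted.

Section backward_induction.
Context {d} {Omega : measurableType d} {R : realType} {n T : nat}.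
Variables (P : probability Omega R) (F : 'I_T.+1 -> set (set Omega)).
Variable M : 'I_T.+1 -> Omega -> euclidean R n.
Hypothesis mart : martingale P F M.
Local Notation path := (path_space R n T).
Variable f : path -> \bar R.

(** This is the invariant of the backward induction. The set [N] is null only for the law of the
    stopped path, so the finite trees have to be kept out of it explicitly. *)
Definition attainable_version (t : nat) (g : path -> R) (N : set path) :=
  [/\ measurable_fun setT g /\ measurable N,
      P.-integrable setT (fun w => (g (stop t (path_of M w)))%:E),
      P [set w | N (stop t (path_of M w))] = 0%E &
      forall h, ~ N h -> attainable f t h (g h)].

Lemma attainable_version_step t g N : (t < T)%N ->
    attainable_version t.+1 g N ->
  exists g' N', attainable_version t g' N' /\
    (\int[P]_w (g' (stop t (path_of M w)))%:E =
     \int[P]_w (g (stop t.+1 (path_of M w)))%:E)%E.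
Proof.
move=> tT [[mg mN] ig N0 att].
have [_ adapt iM condM] := mart.
pose s : 'I_T.+1 := inord t; pose u : 'I_T.+1 := inord t.+1.
have sE : s = t :> nat by rewrite inordK// ltnS ltnW.
have uE : u = t.+1 :> nat by rewrite inordK.
have mp : measurable_fun setT (path_of M) := measurable_path_of mart.
have mMu : measurable_fun setT (M u).
  have := measurableT_comp (measurable_tnth u) mp.
  by rewrite (_ : _ \o _ = M u)//; apply/funext => w /=; rewrite tnth_mktuple.
have mZ : measurable_fun setT (fun w => (stop t (path_of M w), M u w)).
  apply: measurable_fun_pair => //.
  exact: (measurableT_comp (measurable_stop t) mp).
pose Z : {mfun Omega >-> (path * euclidean R n)%type} :=
  HB.pack (fun w => (stop t (path_of M w), M u w)) (isMeasurableFun.Build _ _ _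
    _ _ mZ).
pose mu := distribution P Z.
have extZ w : extend t (Z w).1 (Z w).2 = stop t.+1 (path_of M w).
  by rewrite /= extend_stop -uE stop_succ ?uE//= tnth_mktuple.
have [dU [U [lam [Q dQ]]]] := tuple_disintegration mu.
(* Choosing next positions outside [N'] keeps the extended histories outside [N], where [att]
   applies. *)
pose N' := [set z : path * euclidean R n | N (extend t z.1 z.2)].
have mN' : measurable N'.
  by rewrite -[X in measurable X]setTI; exact: measurable_extend.
have N'0 : mu N' = 0%E.
  rewrite -N0 /mu /distribution /pushforward; congr (P _).
  by apply/seteqP; split=> w; rewrite /N' /= -extZ.
(* The value of [g] and the [n] coordinates of the next position form one vector, so that a single
   convex combination reproduces all their conditional means. *)
pose phi (i : 'I_n.+1) (z : path * euclidean R n) :=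
  if unlift ord0 i is Some k then tnth z.2 k else g (extend t z.1 z.2).
have mphi i : measurable_fun setT (phi i).
  rewrite /phi; case: unlift => [k|].
    exact: (measurableT_comp (measurable_tnth k) measurable_snd).
  exact: (measurableT_comp mg (measurable_extend t)).
have iphiP i : P.-integrable setT (EFin \o phi i \o Z).
  rewrite /phi; case: unlift => [k|]; first exact: iM.
  by apply: eq_integrable ig => // w _; rewrite -extZ.
have iphi i : mu.-integrable setT (EFin \o phi i).
  by apply: integrable_distribution; [exact/measurable_EFinP|exact: iphiP].
have [c0 c0E] := exists_conditional_version dQ (iphi ord0).
(* The conditional mean of the next position is the position of [h] at time [t]; that of [g] is the
   version [c0]. *)
pose c (i : 'I_n.+1) (h : path) : R :=
  if unlift ord0 i is Some k then tnth (tnth h s) k else c0 h.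
have mc k : measurable_fun setT (fun h : path => tnth (tnth h s) k).
  exact: (measurableT_comp (measurable_tnth k) (measurable_tnth s)).
have cM k w : tnth (tnth (stop t (path_of M w)) s) k = component (M s) k w.
  by rewrite tnth_stop ?sE// tnth_mktuple.
have mst : measurable_fun setT (stop t \o path_of M).
  exact: (measurableT_comp (measurable_stop t) mp).
pose st : {mfun Omega >-> path} := HB.pack (stop t \o path_of M)
  (isMeasurableFun.Build _ _ _ _ _ mst).
have margE A : measurable A -> marginal mu A = distribution P st A by [].
have ic k : P.-integrable setT ((fun h : path => (tnth (tnth h s) k)%:E) \o st).
  by apply: eq_integrable (iM s k) => // w _ /=; rewrite cM.
have cphi i : conditional_version mu (phi i) (c i).
  rewrite /phi /c; case: unliftP => [k _|_]; last first.
    by move: c0E; rewrite /phi unlift_none.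
  split.
    have : (distribution P st).-integrable setT (fun h :
      path => (tnth (tnth h s) k)%:E).
      by apply: integrable_distribution; [exact/measurable_EFinP|exact: ic].
    by [].
  move=> A mA.
  have mZA : measurable (Z @^-1` (A `*` setT)).
    by apply: measurable_funPTI; exact: measurableX.
  have mstA : measurable (st @^-1` A) by exact: measurable_funPTI.
  rewrite integral_pushforward//; last 3 first.
  - apply/measurable_EFinP.
    exact: (measurableT_comp (measurable_tnth k) measurable_snd).
  - by apply: (integrableS measurableT) => //; exact: iM.
  - exact: measurableX.
  rewrite (eq_measure_integral (distribution P st)); last by move=> B mB _;
    exact: margE.
  rewrite [RHS]integral_pushforward//; last 2 first.
  - exact/measurable_EFinP.
  - exact: (integrableS measurableT).
  (* The martingale property is used on the event that the history up to [t] lies in [A], which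
     belongs to [F s] by [adapted_stop]. *)
  transitivity (\int[P]_(w in st @^-1` A) (component (M u) k w)%:E)%E.
    congr (integral _ _ _); apply/seteqP; split=> w //=; first by case.
  have su : (s <= u)%N by rewrite sE uE.
  have [_ _ <-] := condM _ _ su k.
    by apply: eq_integral => w _ /=; rewrite cM.
  by have := adapted_stop mart s mA; rewrite sE.
have [N1 [mN1 N10 sN1]] := ae_conditional_combination dQ mN' N'0 iphi cphi.
have [ic0 c0int] := c0E.
have ic0P : P.-integrable setT ((EFin \o c0) \o st).
  have [mc0 ic0'] := integrableP _ _ _ ic0.
  apply/integrableP; split; first exact: measurableT_comp.
  apply: le_lt_trans ic0'.
  rewrite [leRHS](eq_measure_integral (distribution P st)); last first.
    by move=> B mB _; exact: margE.
  by rewrite [leRHS]ge0_integral_pushforward//; exact: measurableT_comp.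
exists c0, N1; split; last first.
  have := c0int setT measurableT; rewrite setXTT.
  rewrite integral_pushforward//; last 2 first.
  - exact/measurable_EFinP.
  - exact: iphiP.
  rewrite [RHS](eq_measure_integral (distribution P st)); last first.
    by move=> B mB _; exact: margE.
  rewrite [RHS]integral_pushforward//; last first.
    exact: (measurable_int _ ic0).
  move=> c0g; rewrite -[LHS]c0g; apply: eq_integral => w _ /=.
  by rewrite /phi unlift_none extZ.
split.
- split=> //.
  by apply/measurable_EFinP; exact: (measurable_int _ ic0).
- exact: ic0P.
- by rewrite -N10.
- move=> h N1h.
  have [J [w [y [w0 w1 Ny wphi]]]] := contrapT (fun nP => N1h (sN1 h nP)).
  have -> : c0 h = \sum_j w j * g (extend t h (y j)).
    by have := wphi ord0; rewrite /phi /c unlift_none => ->.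
  apply: (@attainable_step _ _ _ f t h J w y (fun j => g (extend t h (y j))))
    => // [i|j].
    by have := wphi (lift ord0 i); rewrite /phi /c liftK.
  by apply: att; exact: Ny.
Qed.

End backward_induction.

(** * Integrable real minorants *)

Section real_lower_bound.
Local Open Scope ereal_scope.
Import HBNNSimple.

Lemma integrable_nnsfun d (S : measurableType d) (R : realType)
    (mu : probability S R) (h : {nnsfun S >-> R}) :
  mu.-integrable setT (EFin \o h).
Proof.
apply: measurable_bounded_integrable => //.
  by rewrite ltey_eq fin_num_measure.
have [K [Kr hK]] := compact_bounded (finite_compact (@fimfunP _ _ h)).
by exists K; split=> // k Kk x _; apply: hK Kk _ _; exists x.
Qed.

(** Take a simple function below the positive part of [g] whose integral exceeds [c] plus that of
    the negative part, and subtract the negative part from it. The set [N] is where the latter is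
    infinite. *)
Lemma real_lower_bound d (S : measurableType d) (R : realType)
    (mu : probability S R) (g : S -> \bar R) (c : R) :
    measurable_fun setT g -> c%:E < \int[mu]_x g x ->
  exists (r : S -> R) (N : set S),
    [/\ measurable_fun setT r /\ measurable N, mu N = 0,
        mu.-integrable setT (EFin \o r), c%:E <= \int[mu]_x (r x)%:E &
        forall x, ~ N x -> (r x)%:E <= g x].
Proof.
move=> mg; rewrite integralE.
have mgm : measurable_fun setT g^\- by exact: measurable_funeneg.
have b0 : 0 <= \int[mu]_x g^\- x by exact: integral_ge0.
(* An infinite integral of the negative part would make the whole integral minus infinity, even
   against an infinite positive part, by the convention on differences. *)
have [bfin|] := boolP (\int[mu]_x g^\- x \is a fin_num); last first.
  rewrite ge0_fin_numE// -leNgt leye_eq => /eqP ->.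
  by rewrite addeNy ltNge leNye.
rewrite lteBrDr// [X in _ < X -> _]ge0_integralTE//.
move=> /ereal_sup_gt[_ [h hg <-]].
rewrite -integralT_nnsfun => ch.
have igm : mu.-integrable setT g^\-.
  apply/integrableP; split=> //.
  under eq_integral do rewrite gee0_abs//.
  by rewrite -ge0_fin_numE.
pose fm : S -> R := fine \o g^\-.
have mfgm : measurable_fun setT fm by exact: measurableT_comp.
have ifgm : mu.-integrable setT (EFin \o fm).
  apply: le_integrable igm => //; first exact/measurable_EFinP.
  move=> x _ /=; have := funeneg_ge0 g x.
  rewrite /fm/=; case: (g^\- x) => [r| |]//= _; exact: leey.
have [N [mN N0 sN]] := integrable_ae measurableT igm.
have ih := integrable_nnsfun mu h.
exists (fun x => h x - fm x)%R, N; split=> //.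
- by split=> //; apply: measurable_funB.
- by apply: eq_integrable (integrableB measurableT ih ifgm).
- under eq_integral do rewrite EFinB.
  rewrite (integralB_EFin measurableT ih ifgm).
  have fb : \int[mu]_x (fm x)%:E <= \int[mu]_x g^\- x.
    apply: ge0_le_integral => //.
    + by move=> x _; rewrite lee_fin fine_ge0.
    + exact/measurable_EFinP.
    + move=> x _ /=; have := funeneg_ge0 g x.
      by rewrite /fm/=; case: (g^\- x) => [r| |]//= _; exact: leey.
  apply: le_trans (leeB (lexx _) fb).
  by rewrite leeBrDr// ltW.
- move=> x Nx; have gfin : g^\- x \is a fin_num.
    by apply: contrapT => gx; apply: Nx; apply: sN => /(_ I).
  rewrite [leRHS](_ : _ = g^\+ x - g^\- x);
    last by rewrite [in LHS](funeposneg g).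
  by rewrite EFinB fineK// leeB.
Qed.

End real_lower_bound.

(** * From an arbitrary martingale to time 0, and the equality of suprema *)

Section main.
Context {R : realType} {n T : nat}.
Local Notation path := (path_space R n T).

Lemma attainable_version_start d (Omega : measurableType d)
    (P : probability Omega R) (F : 'I_T.+1 -> set (set Omega))
    (M : 'I_T.+1 -> Omega -> euclidean R n) (f : path -> \bar R) g N k :
    martingale P F M -> (k <= T)%N -> attainable_version P M f k g N ->
  exists g' N', attainable_version P M f 0 g' N' /\
    (\int[P]_w (g' (stop 0 (path_of M w)))%:E =
     \int[P]_w (g (stop k (path_of M w)))%:E)%E.
Proof.
move=> mart; elim: k g N => [|k IH] g N kT gN; first by exists g, N.
have [g1 [N1 [gN1 <-]]] := attainable_version_step mart kT gN.
exact: IH (ltnW kT) gN1.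
Qed.

Lemma martingale_attainable d (Omega : measurableType d)
    (P : probability Omega R) (F : 'I_T.+1 -> set (set Omega))
    (M : 'I_T.+1 -> Omega -> euclidean R n) (x0 : euclidean R n)
    (f : path -> \bar R) (c : R) :
    universally_measurable_fun f -> martingale P F M -> starts_at P M x0 ->
    (c%:E < \int[P]_w f (path_of M w))%E ->
  exists2 c', c <= c' & attainable f 0 [tuple x0 | _ < T.+1] c'.
Proof.
move=> mf mart M0 cf.
have mp := measurable_path_of mart.
pose X : {mfun Omega >-> path} := HB.pack (path_of M) (isMeasurableFun.Build _
  _ _ _ _ mp).
pose L : probability path R := distribution P X.
have [g [mg gf fg]] := lower_version L mf.
have cg : (c%:E < \int[L]_x g x)%E.
  by rewrite -(integral_version mg fg) (@integral_law _ _ _ _ _ P (path_of M) L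
    f mf mp).
have [r [N [[mr mN] N0 ir cr rg]]] := real_lower_bound mg cg.
have irP : P.-integrable setT (fun w => (r (path_of M w))%:E).
  have [_ ir'] := integrableP _ _ _ ir; apply/integrableP; split.
    by apply/measurable_EFinP; exact: measurableT_comp.
  by move: ir'; rewrite ge0_integral_pushforward//;
    do 2 apply: measurableT_comp => //.
(* The induction starts at the horizon, where stopping does nothing and a point mass attains the
   value [r]. *)
have vT : attainable_version P M f T r N.
  split=> //.
  - by under eq_fun do rewrite stop_ge//.
  - by under eq_set do rewrite stop_ge//.
  - by move=> h Nh; apply: attainable_horizon; apply: le_trans (gf h);
      exact: rg.
have [g0 [N1 [[[mg0 mN1] ig0 N10 att] g0r]]] :=
  attainable_version_start mart (leqnn T) vT.
pose h0 : path := [tuple x0 | _ < T.+1].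
have M0h : {ae P, forall w, stop 0 (path_of M w) = h0}.
  apply: filterS M0 => w Mw; apply/eq_from_tnth => i.
  rewrite !tnth_mktuple -Mw; congr (M _ w).
  by apply/val_inj; rewrite /= inordK minn0.
have g0h : (\int[P]_w (g0 (stop 0 (path_of M w)))%:E = (g0 h0)%:E)%E.
  rewrite (ae_eq_integral (cst (g0 h0)%:E))//.
  - by rewrite integral_cst// [X in (_ * X)%E]probability_setT mule1.
  - exact: (measurable_int _ ig0).
  - by apply: filterS M0h => w -> _.
(* The stopped path at time 0 is almost surely [h0], so the null set [N1] cannot contain [h0]. *)
exists (g0 h0); last first.
  apply: att => N1h0.
  have [E [mE E0 sE]] := M0h.
  have : P (~` E) = 0%E.
    apply: (subset_measure0 _ _ _ N10).
    - exact: measurableC.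
    - have := measurableT_comp (measurable_stop 0) mp => /(_ measurableT N1
        mN1).
      by rewrite setTI.
    - move=> w Ew /=; suff -> : stop 0 (path_of M w) = h0 by [].
      by apply: contrapT => /sE.
  by rewrite probability_setC// E0 sube0 => /eqP; rewrite onee_eq0.
rewrite -lee_fin -g0h g0r; under eq_integral do rewrite stop_ge//.
rewrite (le_trans cr)// /L integral_pushforward//.
exact/measurable_EFinP.
Qed.

End main.

Local Open Scope ereal_scope.

Theorem corollary5p2 (R : realType) (n T : nat) (x0 : euclidean R n)
    (f : path_space R n T -> \bar R) (mf : universally_measurable_fun f) :
  ereal_sup [set \int[mu]_x f x | mu in simple_martingale_laws T x0] =
  ereal_sup (martingale_expectations f x0).
Proof.
apply/eqP; rewrite eq_le; apply/andP; split; apply: ge_ereal_sup.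
  (* Every law of a simple martingale is the law of a martingale, and the expectation depends only
     on the law. *)
  move=> _ [mu [d [Om [P [F [M [mart M0 _ muE]]]]]] <-].
  apply: ereal_sup_ubound; exists d, Om, P, F, M; split => //.
  exact: (integral_law mf (measurable_path_of mart) muE).
move=> _ [d [Om [P [F [M [mart M0 ->]]]]]].
(* A rational strictly between the two sides gives a real threshold even when one of them is
   infinite. *)
rewrite leNgt; apply/negP => /rat_between_ereal[q sq].
move=> /(martingale_attainable mf mart M0)[c qc /(attainable_simple_martingale
  mf)].
rewrite tnth_mktuple => -[mu lmu cmu].
move: sq; rewrite ltNge => /negP; apply.
apply: (@le_trans _ _ c%:E); first by rewrite lee_fin.
by apply: (le_trans cmu); apply: ereal_sup_ubound; exists mu.
Qed.
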